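(* Let $K$ be a field, let $R$ be a Koszul standard graded commutative $K$-algebra, let $S=\operatorname{Sym}_K(R_1)$, and let $Z_i=Z_i(\mathfrak m_R)$ be the module of $i$-cycles of the Koszul complex $K(\mathfrak m_R,R)$ associated with the maximal homogeneous ideal $\mathfrak m_R$ of $R$. Then $\operatorname{reg}_R(Z_i)\le 2i$ for every $i\ge 0$. In particular, $t_i^S(R)\le 2i$ for every $i\ge 0$.
   Context: A standard graded $K$-algebra is a commutative $K$-algebra $R=\bigoplus_{i\in\mathbb N}R_i$ with $R_0=K$, $\dim_K R_1<\infty$ and $R_iR_j=R_{i+j}$ for all $i,j\in\mathbb N$ (where $0\in\mathbb N$). Its maximal homogeneous ideal is $\mathfrak m_R=\bigoplus_{i>0}R_i$, and $K=R/\mathfrak m_R$ is regarded as a graded $R$-module. The polynomial ring $S=\operatorname{Sym}_K(R_1)=K[x_1,\dots,x_n]$, $n=\dim_K R_1$, maps canonically onto $R$, so $R$-modules are also $S$-modules. Modules are graded and finitely generated. For a standard graded $K$-algebra $A$ and a finitely generated graded $A$-module $M$, put $\beta^A_{ij}(M)=\dim_K\operatorname{Tor}_i^A(M,K)_j$, $t_i^A(M)=\sup\{j:\beta_{ij}^A(M)\ne 0\}$ (with $t_i^A(M)=-\infty$ if $\operatorname{Tor}_i^A(M,K)=0$), and $\operatorname{reg}_A(M)=\sup\{t_i^A(M)-i: i\ge 0\}$ (so the zero module has regularity $-\infty$). The algebra $R$ is Koszul if $\operatorname{reg}_R(K)=0$, i.e. $\beta^R_{ij}(K)=0$ whenever $i\ne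 j$. The Koszul complex $K(\mathfrak m_R,R)$ is the exterior algebra over $R$ on generators $e_1,\dots,e_n$ of homological degree $1$ and internal degree $1$, with differential the $R$-linear derivation (in the graded sense) determined by $\partial(e_i)=\bar x_i$, where $\bar x_1,\dots,\bar x_n$ is a $K$-basis of $R_1$; it is a complex of graded $R$-modules with differential of internal degree $0$. $Z_i$ is the kernel of $\partial$ in homological degree $i$, with $Z_0=R$. *)

(* Defs.v *)
From HB Require Import structures.
From mathcomp Require Import all_boot all_order all_algebra.
From mathcomp Require Import mpoly.
From mathcomp Require Import boolp classical_sets constructive_ereal.

Set Implicit Arguments.
Unset Strict Implicit.
Unset Printing Implicit Defensive.

Import Order.TTheory GRing.Theory Num.Theory.
Local Open Scope ring_scope.
Local Open Scope classical_set_scope.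

(* V is the internal direct sum of the additive subgroups P i. *)
Record direct_sum (I : choiceType) (V : zmodType) (P : I -> set V) : Prop :=
  DirectSum {
    dsum0 : forall i, P i 0;
    dsumB : forall i x y, P i x -> P i y -> P i (x - y);
    dsum_gen : forall v, exists (s : seq I) (c : I -> V),
      [/\ uniq s, forall i, P i (c i) & v = \sum_(i <- s) c i];
    dsum_free : forall (s : seq I) (c : I -> V),
      uniq s -> (forall i, P i (c i)) -> \sum_(i <- s) c i = 0 ->
      forall i, i \in s -> c i = 0 }.

Lemma sum_widen (I : eqType) (V : nmodType) (f : I -> V) (r t : seq I) :
  uniq r -> uniq t -> {subset r <= t} -> (forall i, i \notin r -> f i = 0) ->
  \sum_(i <- r) f i = \sum_(i <- t) f i.
Proof.
move=> ur ut rt f0; rewrite [RHS](bigID (mem r) predT) /= [X in _ + X]big1 ?addr0.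
  rewrite -[RHS]big_filter; apply: perm_big; apply: uniq_perm => //.
    exact: filter_uniq.
  by move=> j; rewrite mem_filter /=; case: (boolP (j \in r)) => // /rt ->.
by move=> j /f0.
Qed.

Section Components.
Variables (I : choiceType) (V : zmodType) (P : I -> set V).

Lemma direct_sum_of_proj (p : I -> V -> V) :
  (forall i v, P i (p i v)) ->
  (forall i u v, p i (u - v) = p i u - p i v) ->
  (forall i v, P i v -> p i v = v) ->
  (forall i j v, P j v -> i != j -> p i v = 0) ->
  (forall v, exists2 s, uniq s & v = \sum_(i <- s) p i v) -> direct_sum P.
Proof.
move=> pP pB p_id p_ne gen.
have p0 i : p i 0 = 0 by have := pB i 0 0; rewrite !subrr.
have pN i v : p i (- v) = - p i v by rewrite -sub0r pB p0 sub0r.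
have pD i u v : p i (u + v) = p i u + p i v by rewrite -{1}[v]opprK pB pN opprK.
split.
- by move=> i; rewrite -(p0 i); apply: pP.
- by move=> i x y Px Py; rewrite -(p_id _ _ Px) -(p_id _ _ Py) -pB; apply: pP.
- by move=> v; have [s us sv] := gen v; exists s, (p^~ v).
- move=> s c us cP s0 i si.
  have := congr1 (p i) s0; rewrite p0 (big_morph (p i) (pD i) (p0 i)).
  rewrite (bigD1_seq i) //= p_id // big1 ?addr0 // => j ji.
  by apply: (p_ne _ j) => //; rewrite eq_sym.
Qed.

Hypothesis dP : direct_sum P.

Lemma component_exists v : exists c : I -> V,
  exists s : seq I, [/\ uniq s, forall i, P i (c i),
    forall i, i \notin s -> c i = 0 & v = \sum_(i <- s) c i].
Proof.
have [s [c [us cP ->]]] := dsum_gen dP v.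
exists (fun i => if i \in s then c i else 0), s; split => //.
- by move=> i; case: ifP => // _; apply: dsum0.
- by move=> i /negbTE ->.
- by rewrite !big_seq; apply: eq_bigr => i ->.
Qed.

Definition component v : I -> V := projT1 (cid (component_exists v)).

Lemma componentP v : exists s : seq I, [/\ uniq s, forall i, P i (component v i),
  forall i, i \notin s -> component v i = 0 & v = \sum_(i <- s) component v i].
Proof. exact: projT2 (cid (component_exists v)). Qed.

Lemma component_in v i : P i (component v i).
Proof. by have [s []] := componentP v. Qed.

Lemma component_unique v (c : I -> V) (s : seq I) : uniq s ->
  (forall i, P i (c i)) -> (forall i, i \notin s -> c i = 0) ->
  v = \sum_(i <- s) c i -> component v =1 c.
Proof.
move=> us cP cs vs i; have [t [ut dPv dt vt]] := componentP v.
case: (boolP (i \in undup (s ++ t))); last first.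
  by rewrite mem_undup mem_cat negb_or => /andP [/cs -> /dt ->].
move=> ist; apply/eqP; rewrite -subr_eq0; apply/eqP.
apply: (dsum_free dP (s := undup (s ++ t)) (c := fun i => component v i - c i)) => //.
- exact: undup_uniq.
- by move=> j; apply: dsumB.
- rewrite sumrB -(sum_widen ut (undup_uniq _) _ dt); last first.
    by move=> j jt; rewrite mem_undup mem_cat jt orbT.
  rewrite -(sum_widen us (undup_uniq _) _ cs) -?vt -?vs ?subrr //.
  by move=> j js; rewrite mem_undup mem_cat js.
Qed.

Lemma component_id v i : P i v -> component v i = v.
Proof.
move=> Pv; rewrite (component_unique (c := fun j => if j == i then v else 0) (s := [:: i])) ?eqxx //.
- by move=> j; case: eqP => [->|_] //; apply: dsum0.
- by move=> j; rewrite inE => /negbTE ->.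
- by rewrite big_seq1 eqxx.
Qed.

Lemma component_ne v i j : P j v -> i != j -> component v i = 0.
Proof.
move=> Pv ij; rewrite (component_unique (c := fun k => if k == j then v else 0) (s := [:: j])) ?(negbTE ij) //.
- by move=> k; case: eqP => [->|_] //; apply: dsum0.
- by move=> k; rewrite inE => /negbTE ->.
- by rewrite big_seq1 eqxx.
Qed.

Lemma component_sub u v i : component (u - v) i = component u i - component v i.
Proof.
have [s [us uP su eu]] := componentP u; have [t [ut vP tv ev]] := componentP v.
apply: (component_unique (s := undup (s ++ t))
          (c := fun i => component u i - component v i)).
- exact: undup_uniq.
- by move=> j; apply: dsumB.
- move=> j; rewrite mem_undup mem_cat negb_or => /andP [/su -> /tv ->].
  by rewrite subrr.
- rewrite sumrB -(sum_widen us (undup_uniq _) _ su) -?eu; last first.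
    by move=> j js; rewrite mem_undup mem_cat js.
  rewrite -(sum_widen ut (undup_uniq _) _ tv) -?ev //.
  by move=> j jt; rewrite mem_undup mem_cat jt orbT.
Qed.

Lemma component0 i : component 0 i = 0.
Proof. by have := component_sub 0 0 i; rewrite !subrr. Qed.

Lemma componentN v i : component (- v) i = - component v i.
Proof. by rewrite -[- v]sub0r component_sub component0 sub0r. Qed.

Lemma componentD u v i : component (u + v) i = component u i + component v i.
Proof. by rewrite -{1}[v]opprK component_sub componentN opprK. Qed.

End Components.

(* A graded complex of finite free A-modules F_i = \bigoplus_k A(- sh i k),
   given by matrices acting on row vectors on the right, with a map
   F_0 -> N sending the k-th basis vector to cov k. *)
Record free_complex (A : nzRingType) (N : Type) := FreeComplex {
  rk : nat -> nat;
  sh : forall i, 'I_(rk i) -> int;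
  dif : forall i, 'M[A]_(rk i.+1, rk i);
  cov : 'I_(rk 0) -> N }.

Arguments rk {A N} F i : rename.
Arguments sh {A N} F i k : rename.
Arguments dif {A N} F i : rename.
Arguments cov {A N} F k : rename.

Definition zero_complex (A : nzRingType) (N : zmodType) : free_complex A N :=
  FreeComplex (rk := fun=> 0%N) (fun _ _ => 0) (fun=> 0) (fun=> 0).

Section StandardGraded.
Variable K : fieldType.

Record is_standard_graded (A : comAlgType K) (P : nat -> set A) : Prop :=
  IsStandardGraded {
    sgr_sum : direct_sum P;
    sgr_deg0 : P 0 = [set k%:A | k in [set: K]];
    sgr_fin : exists (n : nat) (x : 'I_n -> A),
      P 1 = [set \sum_(i < n) c i *: x i | c in [set: 'I_n -> K]];
    sgr_mul : forall i j, P (i + j)%N = [set a | exists2 s : seq (A * A),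
      (forall u, u \in s -> P i u.1 /\ P j u.2) & a = \sum_(u <- s) u.1 * u.2] }.

Record stdGraded := StdGraded {
  sg_alg :> comAlgType K;
  sg_piece : nat -> set sg_alg;
  sg_ax : is_standard_graded sg_piece }.

(* The grading of A indexed by int, with zero pieces in negative degrees. *)
Definition zpiece (A : stdGraded) (j : int) : set A :=
  if j is Posz d then @sg_piece A d else [set 0].

Lemma zpiece0 (A : stdGraded) j : zpiece j (0 : A).
Proof. by case: j => //= d; apply: dsum0 (sgr_sum (sg_ax A)) _. Qed.

Lemma zpieceB (A : stdGraded) j (a b : A) :
  zpiece j a -> zpiece j b -> zpiece j (a - b).
Proof.
case: j => [d|d] /=; first exact: dsumB (sgr_sum (sg_ax A)) _ _ _.
by move=> -> ->; rewrite subrr.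
Qed.

Lemma sg_pieceM (A : stdGraded) i j (a b : A) :
  sg_piece i a -> sg_piece j b -> sg_piece (i + j) (a * b).
Proof.
move=> Pa Pb; rewrite (sgr_mul (sg_ax A)); exists [:: (a, b)].
  by move=> u; rewrite inE => /eqP ->.
by rewrite big_seq1.
Qed.

Lemma zpieceM (A : stdGraded) i j (a b : A) :
  sg_piece i a -> zpiece j b -> zpiece (i%:Z + j) (a * b).
Proof.
case: j => [d|d] Pa; first exact: sg_pieceM.
by move=> ->; rewrite mulr0; apply: zpiece0.
Qed.

Lemma zpiece_sum (A : stdGraded) : direct_sum (@zpiece A).
Proof.
have dA := sgr_sum (sg_ax A).
apply: (direct_sum_of_proj (p := fun j a => if j is Posz d then component dA a d else 0)).
- by case=> d a //=; apply: component_in.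
- by case=> d a b; rewrite ?component_sub ?subrr.
- by case=> d a //=; apply: component_id.
- case=> i [j|j] a //=.
    by move=> Pa ij; apply: (component_ne _ Pa).
  by move=> -> _; rewrite component0.
- move=> a; have [s [us _ _ ea]] := componentP dA a.
  exists [seq d%:Z | d <- s]; first by rewrite map_inj_uniq // => u v [].
  by rewrite big_map {1}ea.
Qed.

Lemma component_mulz (A : stdGraded) i j (a b : A) : sg_piece i a ->
  component (zpiece_sum A) (a * b) (i%:Z + j) = a * component (zpiece_sum A) b j.
Proof.
move=> Pa; set dZ := zpiece_sum A; have [s [us bP bs eb]] := componentP dZ b.
rewrite (component_unique dZ (c := fun k => a * component dZ b (k - i%:Z))
   (s := [seq i%:Z + k | k <- s])).
- by rewrite addrC addKr.
- by rewrite map_inj_uniq //; apply: addrI.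
- by move=> k; have := zpieceM Pa (bP (k - i%:Z)); rewrite addrC subrK.
- move=> k ks; rewrite bs ?mulr0 //; apply: contra ks => ks.
  by apply/mapP; exists (k - i%:Z); rewrite // addrC subrK.
- rewrite {1}eb mulr_sumr big_map; apply: eq_bigr => k _.
  by rewrite [_ + k]addrC addrK.
Qed.

Section Augmentation.
Variable A : stdGraded.
Let dA := sgr_sum (sg_ax A).

Lemma aug_exists (a : A) : exists k : K, component dA a 0%N = k%:A.
Proof.
have := component_in dA a 0%N; rewrite (sgr_deg0 (sg_ax A)).
by case=> k _ <-; exists k.
Qed.

(* The canonical projection A -> A / m_A = K. *)
Definition aug (a : A) : K := projT1 (cid (aug_exists a)).

Lemma augE a : (aug a)%:A = component dA a 0%N.
Proof. by rewrite -(projT2 (cid (aug_exists a))). Qed.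

Lemma aug_deg0 k : aug (k%:A) = k.
Proof.
apply: (fmorph_inj (GRing.in_alg A)); rewrite /= augE component_id //.
by rewrite (sgr_deg0 (sg_ax A)); exists k.
Qed.

Lemma aug_pos i a : sg_piece i.+1 a -> aug a = 0.
Proof.
move=> Pa; apply: (fmorph_inj (GRing.in_alg A)).
by rewrite /= augE (component_ne _ Pa) // scale0r.
Qed.

Fact aug_is_zmod_morphism : zmod_morphism aug.
Proof.
move=> a b; apply: (fmorph_inj (GRing.in_alg A)).
by rewrite /= scalerBl !augE component_sub.
Qed.

HB.instance Definition _ := GRing.isZmodMorphism.Build A K aug aug_is_zmod_morphism.

Lemma aug_mul_piece i j a b : sg_piece i a -> sg_piece j b ->
  aug (a * b) = aug a * aug b.
Proof.
case: i => [|i] Pa Pb; last first.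
  by rewrite (aug_pos (sg_pieceM Pa Pb)) (aug_pos Pa) mul0r.
case: j Pb => [|j] Pb; last first.
  by rewrite (aug_pos (sg_pieceM Pa Pb)) (aug_pos Pb) mulr0.
move: Pa Pb; rewrite (sgr_deg0 (sg_ax A)) => -[k _ <-] [l _ <-].
by rewrite -scalerAl mul1r scalerA !aug_deg0.
Qed.

Fact aug_is_monoid_morphism : monoid_morphism aug.
Proof.
split=> [|a b]; first by rewrite -[X in aug X](scale1r (1 : A)) aug_deg0.
have [s [_ aP _ ea]] := componentP dA a.
have [t [_ bP _ eb]] := componentP dA b.
rewrite ea eb mulr_suml !raddf_sum mulr_suml; apply: eq_bigr => i _.
rewrite !mulr_sumr raddf_sum; apply: eq_bigr => j _.
exact: aug_mul_piece.
Qed.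

HB.instance Definition _ := GRing.isMonoidMorphism.Build A K aug aug_is_monoid_morphism.

End Augmentation.

(* Restriction of scalars along f. *)
Definition rscal (A B : nzRingType) (f : {rmorphism A -> B}) (V : lmodType B) : Type := V.

Section RestrictScalars.
Variables (A B : nzRingType) (f : {rmorphism A -> B}) (V : lmodType B).
HB.instance Definition _ := GRing.Zmodule.on (rscal f V).
Let act (a : A) (v : rscal f V) : rscal f V := f a *: (v : V).
Fact rscal_actA a b v : act a (act b v) = act (a * b) v.
Proof. by rewrite /act scalerA rmorphM. Qed.
Fact rscal_act1 : left_id 1 act.
Proof. by move=> v; rewrite /act rmorph1 scale1r. Qed.
Fact rscal_actDr : right_distributive act +%R.
Proof. by move=> a u v; rewrite /act scalerDr. Qed.
Fact rscal_actDl v : {morph act^~ v : a b / a + b}.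
Proof. by move=> a b; rewrite /act rmorphD scalerDl. Qed.
HB.instance Definition _ := GRing.Zmodule_isLmodule.Build A (rscal f V)
  rscal_actA rscal_act1 rscal_actDr rscal_actDl.
End RestrictScalars.

(* Graded modules; finite generation plays no role in the definitions below
   and is not part of the structure. *)
Record gmodule (A : stdGraded) := GModule {
  gm_mod :> lmodType A;
  gm_piece : int -> set gm_mod;
  gm_sum : direct_sum gm_piece;
  gm_act : forall (i : nat) (j : int) (a : A) (m : gm_mod),
    sg_piece i a -> gm_piece j m -> gm_piece (i%:Z + j) (a *: m) }.

Section ResidueField.
Variable A : stdGraded.
Definition residue_field : Type := rscal (@aug A) K^o.
HB.instance Definition _ := GRing.Lmodule.on residue_field.

Definition residue_piece (j : int) : set residue_field :=
  if j == 0 then [set: residue_field] else [set 0].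

Fact residue_sum : direct_sum residue_piece.
Proof.
pose p (j : int) (v : residue_field) : residue_field := if j == 0 then v else 0.
apply: (direct_sum_of_proj (p := p)); rewrite /p /residue_piece.
- by move=> j v; case: eqP.
- by move=> j u v; case: eqP => // _; rewrite subrr.
- by move=> j v; case: eqP.
- move=> i j v; case: (eqVneq j 0) => [-> _ /negbTE ->//|_ ->].
  by case: ifP.
- by move=> v; exists [:: 0] => //; rewrite big_seq1 eqxx.
Qed.

Fact residue_act (i : nat) (j : int) (a : A) (m : residue_field) :
  sg_piece i a -> residue_piece j m -> residue_piece (i%:Z + j) (a *: m).
Proof.
rewrite /residue_piece; case: (eqVneq j 0) => [->|_] Pa; last first.
  by move=> ->; rewrite scaler0; case: ifP.
case: i Pa => [//|i] Pa _ /=.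
have -> : a *: m = (aug a : K^o) *: (m : K^o) by [].
by rewrite (aug_pos Pa) scale0r.
Qed.

Definition residue : gmodule A := GModule residue_sum residue_act.
End ResidueField.

Record is_free_resolution (A : stdGraded) (N : gmodule A) (F : free_complex A N) : Prop :=
  IsFreeResolution {
    res_dif : forall i k l, zpiece (sh F i.+1 k - sh F i l) (dif F i k l);
    res_cov : forall k, gm_piece (sh F 0 k) (cov F k);
    res_surj : forall y : N, exists v : 'rV[A]_(rk F 0),
      y = \sum_k v 0 k *: cov F k;
    res_exact0 : forall v : 'rV[A]_(rk F 0),
      \sum_k v 0 k *: cov F k = 0 <-> exists w, v = w *m dif F 0;
    res_exactS : forall i (v : 'rV[A]_(rk F i.+1)),
      v *m dif F i = 0 <-> exists w, v = w *m dif F i.+1 }.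

(* A chosen resolution of N by finite free modules. It exists whenever N is
   finitely generated, A being noetherian; the zero complex is a junk value
   for the other N. *)
Definition resolution (A : stdGraded) (N : gmodule A) : free_complex A N :=
  if pselect (exists F : free_complex A N, is_free_resolution F) is left exF
  then projT1 (cid exF) else zero_complex A N.

Section Tor.
Variables (A : stdGraded) (M N : gmodule A).
Local Notation F := (resolution N).

(* M \otimes_A F_i, where F_i is free with basis 'I_(rk F i). *)
Definition tor_chain (i : nat) : Type := {ffun 'I_(rk F i) -> M}.
HB.instance Definition _ i := GRing.Lmodule.on (tor_chain i).

Definition tor_dif (i : nat) (v : tor_chain i.+1) : tor_chain i :=
  [ffun l => \sum_k dif F i k l *: v k].

Definition tor_deg (i : nat) (j : int) : set (tor_chain i) :=
  [set v | forall k, gm_piece (j - sh F i k) (v k)].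

Definition tor_cycle (i : nat) (j : int) : set (tor_chain i) :=
  tor_deg j `&` (if i is i'.+1 then [set v : tor_chain i'.+1 | tor_dif v = 0] else setT).

Definition tor_boundary (i : nat) (j : int) : set (tor_chain i) :=
  [set tor_dif w | w in @tor_deg i.+1 j].

End Tor.

(* dim_K (Z / B) as an extended integer, for K-subspaces B of Z. *)
Definition quotient_dim (A : comAlgType K) (V : lmodType A) (Z B : set V) : \bar int :=
  supremum -oo%E [set (n%:Z)%:E | n in [set n : nat | exists v : 'I_n -> V,
    (forall k, Z (v k)) /\
    (forall c : 'I_n -> K, B (\sum_k (c k)%:A *: v k) -> forall k, c k = 0)]].

(* dim_K Tor_i^A(M, N)_j, and the invariants derived from it. *)
Definition tor_dim (A : stdGraded) (M N : gmodule A) (i : nat) (j : int) : \bar int :=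
  quotient_dim (@tor_cycle A M N i j) (@tor_boundary A M N i j).

Definition betti (A : stdGraded) (M : gmodule A) (i : nat) (j : int) : \bar int :=
  tor_dim M (residue A) i j.

Definition top_degree (A : stdGraded) (M : gmodule A) (i : nat) : \bar int :=
  supremum -oo%E [set j%:E | j in [set j : int | betti M i j != 0%E]].

Definition regularity (A : stdGraded) (M : gmodule A) : \bar int :=
  supremum -oo%E [set (top_degree M i - (i%:Z)%:E)%E | i in [set: nat]].

Definition koszul (A : stdGraded) : Prop := regularity (residue A) = 0%E.

Record linear_basis (A : stdGraded) (n : nat) := LinearBasis {
  lb_fun :> 'I_n -> A;
  lb_in : forall i, sg_piece 1 (lb_fun i);
  lb_span : forall a, sg_piece 1 a -> exists c : 'I_n -> K, a = \sum_i c i *: lb_fun i;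
  lb_free : forall c : 'I_n -> K, \sum_i c i *: lb_fun i = 0 -> forall i, c i = 0 }.

End StandardGraded.

Section PolynomialRing.
Variables (K : fieldType) (n : nat).

Definition mpoly_piece (d : nat) : set {mpoly K[n]} := [set p | p \is d.-homog].

Fact mpoly_direct_sum : direct_sum mpoly_piece.
Proof.
apply: (direct_sum_of_proj (p := fun d => pihomog mdeg d)); rewrite /mpoly_piece /=.
- by move=> d p; apply: pihomogP.
- by move=> d p q; rewrite pihomogB.
- by move=> d p; apply: pihomog_dE.
- by move=> i j p hp ij; apply: (@pihomog_ne0 _ _ _ j) => //; rewrite eq_sym.
- move=> p; exists (iota 0 (msize p)); first exact: iota_uniq.
  have := @pihomog_partitionE n K mdeg (msize p) p (leqnn _).
  by rewrite -(big_mkord predT (fun d => pihomog mdeg d p)) /index_iota subn0.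
Qed.

Lemma mnm_split (i j : nat) (m : 'X_{1..n}) : mdeg m = (i + j)%N ->
  exists m1 m2 : 'X_{1..n}, [/\ mdeg m1 = i, mdeg m2 = j & m = (m1 + m2)%MM].
Proof.
elim: i j => [|i IH] j; first by exists 0%MM, m; rewrite mdeg0 add0m.
rewrite addSnnS => /IH [m1 [m2 [d1 d2 em]]].
have [k k0] : exists k, m2 k != 0%N.
  apply/existsP; rewrite -negb_forall; apply/negP => /forallP m20.
  have : mdeg m2 = 0%N by rewrite mdegE big1 // => k _; apply/eqP.
  by rewrite d2.
exists (m1 + U_(k))%MM, (m2 - U_(k))%MM.
have le : (U_(k) <= m2)%MM by rewrite lep1mP.
split; first by rewrite mdegD mdeg1 d1 addn1.
  by have := congr1 mdeg (submK le); rewrite mdegD mdeg1 d2 addn1 => -[].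
by rewrite -addmA [(U_(k) + _)%MM]addmC submK.
Qed.

Fact mpoly_is_standard_graded : is_standard_graded mpoly_piece.
Proof.
split; first exact: mpoly_direct_sum.
- apply/seteqP; split=> [p|p [k _ <-]]; rewrite /mpoly_piece /=; last first.
    by apply: dhomogZ; apply: dhomog1.
  move=> hp; exists p@_0%MM => //; apply/mpolyP => m.
  rewrite mcoeffZ mcoeff1; case: (eqVneq m 0%MM) => [->|m0]; first by rewrite mulr1.
  by rewrite mulr0 (dhomog_nemf_coeff hp) // mdeg_eq0.
- exists n, (fun i => 'X_i); apply/seteqP; split=> [p|p [c _ <-]]; rewrite /mpoly_piece /=.
    move=> hp; exists (fun i => p@_(U_(i)%MM)) => //; apply/mpolyP => m.
    rewrite raddf_sum /=; case: (eqVneq (mdeg m) 1%N) => [/eqP/mdeg1P [k /eqP ->]|m1].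
      rewrite (bigD1 k) //= mcoeffZ mcoeffX eqxx mulr1 big1 ?addr0 // => i ik.
      by rewrite mcoeffZ mcoeffX eq_mnm1 (negbTE ik) mulr0.
    rewrite (dhomog_nemf_coeff hp m1) big1 // => i _.
    rewrite mcoeffZ mcoeffX; case: eqP => [im|]; last by rewrite mulr0.
    by move: m1; rewrite -im mdeg1.
  by apply: rpred_sum => i _; apply: dhomogZ; rewrite dhomogX /= mdeg1.
- move=> i j; apply/seteqP; split=> [p|p [s sP ->]]; rewrite /mpoly_piece /=; last first.
    rewrite big_seq; apply: rpred_sum => u /sP [u1 u2]; exact: dhomogM.
  move=> hp.
  have split_m m : exists u : {mpoly K[n]} * {mpoly K[n]}, m \in msupp p ->
      [/\ u.1 \is i.-homog, u.2 \is j.-homog & u.1 * u.2 = p@_m *: 'X_[m]].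
    case: (boolP (m \in msupp p)) => [mp|_]; last by exists (0, 0).
    have [m1 [m2 [d1 d2 em]]] := mnm_split (dhomog_mf hp mp).
    exists (p@_m *: 'X_[m1], 'X_[m2]) => _; split => /=.
    + by apply: dhomogZ; rewrite dhomogX; apply/eqP.
    + by rewrite dhomogX; apply/eqP.
    + by rewrite -scalerAl -mpolyXD em.
  have [g gP] := choice split_m.
  exists [seq g m | m <- msupp p].
    by move=> u /mapP [m mp ->]; have [] := gP m mp.
  rewrite big_map {1}[p]mpolyE !big_seq; apply: eq_bigr => m mp.
  by have [_ _ ->] := gP m mp.
Qed.

Definition mpoly_graded : stdGraded K := StdGraded mpoly_is_standard_graded.

End PolynomialRing.

Section Koszul.
Variables (K : fieldType) (R : stdGraded K) (n : nat) (x : linear_basis R n).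

(* R as a graded module over S = K[x_1..x_n], along the canonical map S -> R. *)
Definition sym_map : {mpoly K[n]} -> R := mmap (GRing.in_alg R) x.
HB.instance Definition _ := GRing.RMorphism.on sym_map.

Lemma sg_pieceZ d (c : K) (a : R) : sg_piece d a -> sg_piece d (c *: a).
Proof.
move=> Pa; rewrite -[d]add0n -[c *: a]mul1r -scalerAr scalerAl.
apply: sg_pieceM => //; rewrite (sgr_deg0 (sg_ax R)).
by exists c.
Qed.

Lemma sg_pieceD d (a b : R) : sg_piece d a -> sg_piece d b -> sg_piece d (a + b).
Proof.
have dR := sgr_sum (sg_ax R); move=> Pa Pb.
have : sg_piece d (0 - b) by apply: (dsumB dR) => //; apply: (dsum0 dR).
by move=> PNb; rewrite -[b]opprK -[- b]sub0r; apply: (dsumB dR).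
Qed.

Lemma sg_piece1 : sg_piece 0 (1 : R).
Proof. by rewrite (sgr_deg0 (sg_ax R)); exists 1 => //; rewrite scale1r. Qed.

Lemma sym_map_piece d p : p \is d.-homog -> sg_piece d (sym_map p).
Proof.
move=> hp; rewrite /sym_map /mmap big_seq.
apply: (big_ind (@sg_piece K R d)).
- exact: dsum0 (sgr_sum (sg_ax R)) _.
- exact: sg_pieceD.
move=> m mp; rewrite -scalerAl mul1r; apply: sg_pieceZ.
rewrite -(dhomog_mf hp mp) /= mdegE /mmap1.
apply: (big_rec2 (fun a d => sg_piece d a)); first exact: sg_piece1.
move=> i k a _ Pa; apply: sg_pieceM => //.
elim: (m i) => [|e IH]; first exact: sg_piece1.
by rewrite exprS -add1n; apply: sg_pieceM => //; apply: lb_in.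
Qed.

Definition over_sym_mod : Type := rscal sym_map R^o.
HB.instance Definition _ := GRing.Lmodule.on over_sym_mod.

Fact over_sym_act i j (p : mpoly_graded K n) (r : over_sym_mod) :
  sg_piece i p -> zpiece j (r : R) -> zpiece (i%:Z + j) (p *: r : over_sym_mod).
Proof. by move=> Pp Pr; apply: zpieceM => //; apply: sym_map_piece. Qed.

Definition over_sym : gmodule (mpoly_graded K n) :=
  @GModule _ (mpoly_graded K n) over_sym_mod _ (zpiece_sum R) over_sym_act.

(* The exterior algebra on e_0, .., e_(n-1): z is \sum_I z I * e_I, where e_I is
   the product of the e_i, i in I, in increasing order; e_I has homological
   and internal degree #|I|. *)
Definition exterior : Type := {ffun {set 'I_n} -> R^o}.
HB.instance Definition _ := GRing.Lmodule.on exterior.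

(* The derivation e_i |-> x_i: the coefficient of e_J in the image of e_I is
   (-1)^#{j in J : j < i} * x_i if I = J + i with i not in J, and 0 otherwise. *)
Definition kdif (z : exterior) : exterior :=
  [ffun J : {set 'I_n} => \sum_(i | i \notin J)
     (-1) ^+ #|[set j in J | (j < i)%N]| * x i * z (i |: J)].

Fact kdif_is_linear : linear kdif.
Proof.
move=> a u v; apply/ffunP => J; rewrite !ffunE scaler_sumr -big_split /=.
apply: eq_bigr => i _; rewrite !ffunE mulrDr; congr (_ + _).
by rewrite /GRing.scale /= mulrCA.
Qed.

HB.instance Definition _ := GRing.isLinear.Build R exterior exterior _ kdif kdif_is_linear.

Definition kcycle_pred (i : nat) : {pred exterior} :=
  [pred z : exterior | [forall I : {set 'I_n}, (#|I| != i) ==> (z I == 0)]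
                       && (kdif z == 0)].

Fact kcycle_submod_closed i : submod_closed (kcycle_pred i).
Proof.
split=> [|a u v].
  rewrite inE linear0 eqxx andbT; apply/forallP => I; apply/implyP => _.
  by rewrite ffunE.
rewrite !inE => /andP[/forallP u0 /eqP du] /andP[/forallP v0 /eqP dv].
rewrite (_ : kdif _ = 0) ?eqxx ?andbT; last first.
  by rewrite [LHS](kdif_is_linear a u v) du dv scaler0 addr0.
apply/forallP => I; apply/implyP => iI; rewrite !ffunE.
by rewrite (eqP (implyP (u0 I) iI)) (eqP (implyP (v0 I) iI)) scaler0 addr0.
Qed.

HB.instance Definition _ i := GRing.isSubmodClosed.Build R exterior
  (kcycle_pred i) (kcycle_submod_closed i).

(* Z_i(m_R) *)
Record kcycle (i : nat) : Type :=
  KCycle { kcycle_val :> exterior; _ : kcycle_val \in kcycle_pred i }.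

HB.instance Definition _ i := [isSub for @kcycle_val i].
HB.instance Definition _ i := [Choice of kcycle i by <:].
HB.instance Definition _ i := [SubChoice_isSubLmodule of kcycle i by <:].

Definition kcycle_piece (i : nat) (j : int) : set (kcycle i) :=
  [set z : kcycle i | forall I : {set 'I_n}, zpiece (j - i%:Z) (kcycle_val z I : R)].

Let dZ := zpiece_sum R.
Let hproj (d : int) (z : exterior) : exterior := [ffun I => component dZ (z I : R) d].

Let hproj_dif d z : kdif (hproj d z) = hproj (1 + d) (kdif z).
Proof.
apply/ffunP => J; rewrite !ffunE.
rewrite (big_morph (fun a => component dZ a (1 + d)) 
  (fun a b => componentD dZ a b _) (component0 dZ _)).
apply: eq_bigr => i _; rewrite ffunE -!mulrA -signr_odd !mulr_sign.
by case: ifP => _; rewrite ?componentN (component_mulz d (z _) (lb_in x i)).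
Qed.

Let hproj_cycle i d (z : kcycle i) : hproj d z \in kcycle_pred i.
Proof.
case: z => z /=; rewrite !inE => /andP[/forallP z0 /eqP dz].
apply/andP; split; last by apply/eqP/ffunP => J; rewrite hproj_dif dz !ffunE component0.
by apply/forallP => I; apply/implyP => iI; rewrite ffunE (eqP (implyP (z0 I) iI)) component0.
Qed.

Fact kcycle_sum i : direct_sum (@kcycle_piece i).
Proof.
apply: (direct_sum_of_proj (p := fun j z => KCycle (hproj_cycle (j - i%:Z) z))).
- by move=> j z I; rewrite ffunE; apply: component_in.
- move=> j u v; apply: val_inj; apply/ffunP => I; rewrite !ffunE.
  exact: component_sub.
- by move=> j z Pz; apply: val_inj; apply/ffunP => I; rewrite !ffunE component_id.
- move=> j k z Pz jk; apply: val_inj; apply/ffunP => I; rewrite !ffunE.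
  by apply: (component_ne _ (Pz I)); rewrite (inj_eq (addIr _)).
- move=> z.
  pose S (I : {set 'I_n}) := projT1 (cid (componentP dZ (kcycle_val z I : R))).
  have SP I := projT2 (cid (componentP dZ (kcycle_val z I : R))).
  pose T := undup (flatten (codom S)).
  exists [seq k + i%:Z | k <- T].
    by rewrite map_inj_uniq ?undup_uniq //; apply: addIr.
  apply: val_inj; apply/ffunP => I; rewrite big_map raddf_sum sum_ffunE /=.
  have [uS _ S0 eS] := SP I; rewrite {1}eS.
  rewrite (sum_widen uS (undup_uniq _) _ S0 (t := T)).
    by apply: eq_bigr => k _; rewrite ffunE addrK.
  move=> k kS; rewrite mem_undup; apply/flattenP; exists (S I) => //.
  exact: codom_f.
Qed.

Fact kcycle_act i (d : nat) (j : int) (a : R) (z : kcycle i) :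
  sg_piece d a -> kcycle_piece j z -> kcycle_piece (d%:Z + j) (a *: z).
Proof. by move=> Pa Pz I; rewrite ffunE -addrA; apply: zpieceM. Qed.

Definition koszul_cycles (i : nat) : gmodule R := GModule (@kcycle_sum i) (@kcycle_act i).

End Koszul.

(* Main.v *)
Require Import Defs.
From mathcomp Require Import all_boot all_order all_algebra.
From mathcomp Require Import mpoly.
From mathcomp Require Import boolp classical_sets constructive_ereal.
From mathcomp Require Import ring zify.


(** Write [Z_i] and [B_i] for the cycles and boundaries of the Koszul complex
    and [H_i = Z_i / B_i]. The bound on the regularity of [Z_i] goes by induction
    on [i] along the exact sequences [0 -> B_i -> Z_i -> H_i -> 0] and
    [0 -> Z_(i+1) -> K_(i+1) -> B_i -> 0]. Multiplication by each [x_l] is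
    null-homotopic on the Koszul complex ([wedge_homotopy]), so [H_i] is killed by
    the maximal ideal: it is a direct sum of shifted copies of the residue field,
    and since the residue field has a linear resolution the regularity of [H_i]
    is its top degree ([tor_vanishes_vector_space]). The top degree of [H_i] is at
    most the top degree of a minimal generator of [Z_i]
    ([tor_vanishes_generators]), hence at most [reg Z_i]. The first sequence then
    gives [reg B_i <= reg Z_i + 1] ([tor_vanishes_sub]), and the second, whose
    middle term is free and generated in degree [i + 1], gives
    [reg Z_(i+1) <= max (i + 1, reg Z_i + 2)] ([tor_vanishes_ker], [tor_vanishes_kcyc]).

    For the second bound, [Tor_i^S(R, K)] is the Koszul homology [H_i], which
    vanishes above degree [2 i] by the above ([kcyc_sub_kbound]). This
    identification rests on two facts: Tor does not depend on the resolution
    ([tor_vanishes_comparison]), and the Koszul complex of the polynomial ring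
    resolves the residue field ([kos_complex_resolution]). The latter is checked
    multidegree by multidegree: a cycle [w] whose multidegree involves [x_l] has
    [e_l w] divisible by [x_l], and the quotient has boundary [w].

    Everything is phrased through a single predicate, [tor_vanishes F Z B p j]:
    for graded submodules [B] and [Z] of an ambient module, every chain of
    [Z \otimes F_p] of degree [j] that is a cycle modulo [B] is a boundary modulo
    [B]. Working with pairs of submodules of the exterior algebra replaces the
    quotients [H_i] and the long exact sequences by short chases of tuples. *)

Set Implicit Arguments.
Unset Strict Implicit.
Unset Printing Implicit Defensive.

Import Order.TTheory GRing.Theory Num.Theory.
Local Open Scope ring_scope.
Local Open Scope classical_set_scope.

(** * Homogeneous matrices *)

Section HomogeneousMatrices.
Variables (K : fieldType) (A : stdGraded K).
Local Notation dA := (zpiece_sum A).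

Lemma zpieceMz i j (a b : A) : zpiece i a -> zpiece j b -> zpiece (i + j) (a * b).
Proof.
case: i => [d|d] Pa; first exact: zpieceM.
by move: Pa => /= ->; rewrite mul0r => _; apply: zpiece0.
Qed.

Lemma zpiece_bigsum (I : Type) (s : seq I) (P : pred I) (f : I -> A) j :
  (forall i, P i -> zpiece j (f i)) -> zpiece j (\sum_(i <- s | P i) f i).
Proof.
move=> fP; apply: (big_ind (zpiece j)) => //; first exact: zpiece0.
by move=> a b Pa Pb; rewrite -[b]opprK -[- b]sub0r; do 2!apply: zpieceB => //; apply: zpiece0.
Qed.

Lemma component_sum (I : choiceType) (V : zmodType) (P : I -> set V)
    (dP : direct_sum P) (J : Type) (s : seq J) (f : J -> V) d :
  component dP (\sum_(i <- s) f i) d = \sum_(i <- s) component dP (f i) d.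
Proof.
by rewrite (big_morph (fun a => component dP a d)
  (fun a b => componentD dP a b _) (component0 dP _)).
Qed.

Lemma component_mul_homog i j (a b : A) : zpiece j b ->
  component dA (a * b) (i + j) = component dA a i * b.
Proof.
case: j => [d|d] Pb; first by rewrite mulrC addrC component_mulz // mulrC.
by move: Pb => /= ->; rewrite !mulr0 component0.
Qed.

Lemma component_act_homog (N : gmodule A) i j (a : A) (y : N) : gm_piece j y ->
  component (gm_sum N) (a *: y) (i + j) = component dA a i *: y.
Proof.
have dN := gm_sum N; move=> Py; have [s [us aP a0 ea]] := componentP dA a.
rewrite (component_unique (gm_sum N) (c := fun k => component dA a (k - j) *: y)
  (s := [seq k + j | k <- s])).
- by rewrite addrK.
- by rewrite map_inj_uniq //; apply: addIr.
- move=> k; have := aP (k - j); case E: (k - j) => [d|d] /=.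
    by move/gm_act/(_ Py); rewrite -E subrK.
  by move=> ->; rewrite scale0r; apply: dsum0 dN _.
- move=> k ks; rewrite a0 ?scale0r //; apply: contra ks => ks.
  by apply/mapP; exists (k - j); rewrite ?subrK.
- rewrite {1}ea scaler_suml big_map; apply: eq_bigr => k _.
  by rewrite addrK.
Qed.

(** A homogeneous matrix of degree [0] between the free modules with basis
    degrees [a] and [b]. *)
Definition homog_mx m n (a : 'I_m -> int) (b : 'I_n -> int) (X : 'M[A]_(m, n)) :=
  forall k l, zpiece (a k - b l) (X k l).

Lemma homog_mxM m n p (a : 'I_m -> int) (b : 'I_n -> int) (c : 'I_p -> int) X Y :
  homog_mx a b X -> homog_mx b c Y -> homog_mx a c (X *m Y).
Proof.
move=> hX hY k l; rewrite mxE; apply: zpiece_bigsum => r _.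
by rewrite -[a k - c l](subrKA (b r)); apply: zpieceMz.
Qed.

Lemma homog_mxB m n (a : 'I_m -> int) (b : 'I_n -> int) X Y :
  homog_mx a b X -> homog_mx a b Y -> homog_mx a b (X - Y).
Proof. by move=> hX hY k l; rewrite !mxE; apply: zpieceB. Qed.

Lemma homog_mx1 m (a : 'I_m -> int) : homog_mx a a 1%:M.
Proof.
move=> k l; rewrite mxE; case: eqP => [->|_]; last exact: zpiece0.
by rewrite subrr; apply: sg_piece1.
Qed.

(** Taking the degree [0] part of a factor preserves a factorization of
    homogeneous matrices, so lifting problems can be solved without regard to
    degrees. *)
Lemma homog_mx_lift m n p (a : 'I_m -> int) (b : 'I_n -> int) (c : 'I_p -> int)
    (X : 'M[A]_(m, p)) (D : 'M[A]_(n, p)) :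
  homog_mx a c X -> homog_mx b c D ->
  (forall k, exists w, row k X = w *m D) ->
  exists2 W, homog_mx a b W & X = W *m D.
Proof.
move=> hX hD /choice [w wP].
exists (\matrix_(k, l) component dA (w k 0 l) (a k - b l)).
  by move=> k l; rewrite mxE; apply: component_in.
apply/matrixP => k r; rewrite -[LHS](component_id dA (hX k r)).
have -> : X k r = \sum_l w k 0 l * D l r.
  by have /matrixP/(_ 0 r) := wP k; rewrite !mxE.
rewrite component_sum mxE; apply: eq_bigr => l _; rewrite !mxE.
by rewrite -[a k - c r](subrKA (b l)) component_mul_homog.
Qed.

End HomogeneousMatrices.

(** * Families of graded submodules and chains *)

Section Chains.
Variables (A : comNzRingType) (V : lmodType A).

(** The map on tuples of elements of [V] induced by [X] on row vectors. *)
Definition mxact m n (X : 'M[A]_(m, n)) (v : 'I_m -> V) : 'I_n -> V :=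
  fun l => \sum_k X k l *: v k.

Lemma mxactM m n p (X : 'M[A]_(m, n)) (Y : 'M[A]_(n, p)) v :
  mxact (X *m Y) v =1 mxact Y (mxact X v).
Proof.
move=> l; rewrite /mxact.
under eq_bigr do rewrite mxE scaler_suml.
rewrite exchange_big; apply: eq_bigr => r _ /=.
by rewrite scaler_sumr; apply: eq_bigr => k _; rewrite scalerA mulrC.
Qed.

Lemma mxactB m n (X : 'M[A]_(m, n)) u v :
  mxact X (fun k => u k - v k) =1 fun l => mxact X u l - mxact X v l.
Proof. by move=> l; rewrite /mxact -sumrB; apply: eq_bigr => k _; rewrite scalerBr. Qed.

Lemma mxactBl m n (X Y : 'M[A]_(m, n)) v :
  mxact (X - Y) v =1 fun l => mxact X v l - mxact Y v l.
Proof. by move=> l; rewrite /mxact -sumrB; apply: eq_bigr => k _; rewrite !mxE scalerBl. Qed.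

Lemma mxactDl m n (X Y : 'M[A]_(m, n)) v :
  mxact (X + Y) v =1 fun l => mxact X v l + mxact Y v l.
Proof. by move=> l; rewrite /mxact -big_split; apply: eq_bigr => k _; rewrite !mxE scalerDl. Qed.

Lemma mxact1 m v : mxact (1%:M : 'M[A]_m) v =1 v.
Proof.
move=> l; rewrite /mxact (bigD1 l) //= mxE eqxx scale1r big1 ?addr0 // => k kl.
by rewrite mxE (negbTE kl) scale0r.
Qed.

Lemma mxact0l m n v : mxact (0 : 'M[A]_(m, n)) v =1 fun=> 0.
Proof. by move=> l; rewrite /mxact big1 // => k _; rewrite mxE scale0r. Qed.

Lemma mxact0 m n (X : 'M[A]_(m, n)) v : v =1 (fun=> 0) -> mxact X v =1 fun=> 0.
Proof. by move=> v0 l; rewrite /mxact big1 // => k _; rewrite v0 scaler0. Qed.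

Lemma eq_mxact m n (X : 'M[A]_(m, n)) u v : u =1 v -> mxact X u =1 mxact X v.
Proof. by move=> uv l; apply: eq_bigr => k _; rewrite uv. Qed.

Lemma mxact_linear (W : lmodType A) (f : {linear V -> W}) m n (X : 'M[A]_(m, n)) v l :
  f (mxact X v l) = \sum_k X k l *: f (v k).
Proof. by rewrite linear_sum; apply: eq_bigr => k _; rewrite linearZ. Qed.

End Chains.

Section GradedSubmodules.
Variables (K : fieldType) (A : stdGraded K) (V : lmodType A).

(** The pieces [Z j] of a graded submodule of [V]; no grading of [V] itself is
    fixed, which lets the same family of vectors be used with different
    shifts. *)
Record graded_sub (Z : int -> set V) : Prop := GradedSub {
  gsub0 : forall j, Z j 0;
  gsubB : forall j u v, Z j u -> Z j v -> Z j (u - v);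
  gsubZ : forall i j a v, zpiece i a -> Z j v -> Z (i + j) (a *: v) }.

Lemma gsubD Z (gZ : graded_sub Z) j u v : Z j u -> Z j v -> Z j (u + v).
Proof.
move=> Zu Zv; rewrite -[v]opprK -[- v]sub0r.
by apply: gsubB => //; apply: gsubB => //; apply: gsub0.
Qed.

Lemma gsub_sum Z (gZ : graded_sub Z) j (I : Type) (s : seq I) (P : pred I) f :
  (forall i, P i -> Z j (f i)) -> Z j (\sum_(i <- s | P i) f i).
Proof. by move=> fZ; apply: big_ind => //; [apply: gsub0|move=> u v; apply: gsubD]. Qed.

Lemma gsub_mxact Z (gZ : graded_sub Z) m n (a : 'I_m -> int) (b : 'I_n -> int)
    (X : 'M[A]_(m, n)) (v : 'I_m -> V) j : homog_mx a b X ->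
  (forall k, Z (j - a k) (v k)) -> forall l, Z (j - b l) (mxact X v l).
Proof.
move=> hX vZ l; apply: gsub_sum => // k _.
have -> : j - b l = (a k - b l) + (j - a k) by ring.
exact: gsubZ.
Qed.

Definition zero_sub : int -> set V := fun=> [set 0].

End GradedSubmodules.

Arguments zero_sub {K A V}.

Lemma gm_graded_sub (K : fieldType) (A : stdGraded K) (N : gmodule A) :
  graded_sub (@gm_piece _ _ N).
Proof.
have dN := gm_sum N; split=> [j|j u v|[i|i] j a v]; [exact: dsum0 dN _|exact: dsumB dN _ _ _|exact: gm_act|].
by move=> /= -> _; rewrite scale0r; apply: dsum0 dN _.
Qed.

(** * Vanishing of relative Tor *)

Section PreviousDifferential.
Variables (A : nzRingType) (N : Type) (F : free_complex A N).

(** The differential leaving [F_p], with target [0] when [p = 0]; it makes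
    statements about cycles uniform in [p]. *)
Definition out_rk p := if p is q.+1 then rk F q else 0%N.

Definition out_sh p : 'I_(out_rk p) -> int :=
  match p with 0 => fun=> 0 | q.+1 => sh F q end.

Definition out_dif p : 'M[A]_(rk F p, out_rk p) :=
  match p with 0 => 0 | q.+1 => dif F q end.

End PreviousDifferential.

Section TorVanishing.
Variables (K : fieldType) (A : stdGraded K) (N : gmodule A).
Variable F : free_complex A N.

(** For graded submodules [B] and [Z] of [V] with [B] inside [Z], this is the
    vanishing in degree [j] of the [p]-th homology of [(Z / B) \otimes F],
    without forming the quotient. *)
Definition tor_vanishes (V : lmodType A) (Z B : int -> set V) (p : nat) (j : int) :=
  forall v : 'I_(rk F p) -> V, (forall k, Z (j - sh F p k) (v k)) ->
  (forall l, B (j - out_sh l) (mxact (out_dif F p) v l)) ->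
  exists w : 'I_(rk F p.+1) -> V, (forall k, Z (j - sh F p.+1 k) (w k)) /\
    forall k, B (j - sh F p k) (v k - mxact (dif F p) w k).

Hypothesis hF : is_free_resolution F.

Lemma homog_dif p : homog_mx (sh F p.+1) (sh F p) (dif F p).
Proof. by move=> k l; apply: res_dif hF _ _ _. Qed.

Lemma homog_out_dif p : homog_mx (sh F p) (@out_sh _ _ F p) (out_dif F p).
Proof. by case: p => [|p] k l /=; [case: l|apply: homog_dif]. Qed.

Lemma dif_out_dif p : dif F p *m out_dif F p = 0.
Proof.
case: p => [|p] /=; first by rewrite mulmx0.
apply/row_matrixP => k; rewrite row_mul row0; apply/(res_exactS hF).
by exists (row k 1%:M); rewrite -row_mul mul1mx.
Qed.

Lemma mxact_dif_dif (V : lmodType A) p (v : 'I_(rk F p.+1) -> V) :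
  mxact (out_dif F p) (mxact (dif F p) v) =1 fun=> 0.
Proof. by move=> l; rewrite -mxactM dif_out_dif mxact0l. Qed.

Lemma dif_cov l : \sum_k dif F 0 l k *: cov F k = 0.
Proof.
have /(res_exact0 hF) : exists w, row l (dif F 0) = w *m dif F 0.
  by exists (row l 1%:M); rewrite -row_mul mul1mx.
by move=> e; rewrite -[RHS]e; apply: eq_bigr => k _; rewrite mxE.
Qed.

(** The part [Tor_(p+2) (Z / B) -> Tor_(p+1) B -> Tor_(p+1) Z] of the long exact
    sequence. *)
Lemma tor_vanishes_sub (V : lmodType A) (Z B : int -> set V) p j :
  graded_sub B -> graded_sub Z -> (forall e, B e `<=` Z e) ->
  tor_vanishes Z zero_sub p.+1 j -> tor_vanishes Z B p.+2 j ->
  tor_vanishes B zero_sub p.+1 j.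
Proof.
move=> gB gZ BZ TZ TH v vB dv.
have [w [wZ vw]] := TZ v (fun k => BZ _ _ (vB k)) dv.
have ew k : mxact (dif F p.+1) w k = v k.
  by apply/esym/eqP; rewrite -subr_eq0; apply/eqP/vw.
have [|u [uZ wu]] := TH w wZ; first by move=> l; rewrite /= ew.
exists (fun k => w k - mxact (dif F p.+2) u k); split=> // k.
by rewrite /zero_sub /= mxactB ew (mxact_dif_dif u) subr0 subrr.
Qed.

(** The part [Tor_(p+1) (f X) -> Tor_p (ker f) -> Tor_p X] of the long exact
    sequence. *)
Lemma tor_vanishes_ker (V W : lmodType A) (f : {linear V -> W}) (X : int -> set V) p j :
  graded_sub X -> tor_vanishes X zero_sub p j ->
  tor_vanishes (fun e => f @` X e) zero_sub p.+1 j ->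
  tor_vanishes (fun e => X e `&` [set z | f z = 0]) zero_sub p j.
Proof.
move=> gX TX TB v vZ dv.
have [w [wX vw]] := TX v (fun k => (vZ k).1) dv.
have ew k : mxact (dif F p) w k = v k.
  by apply/esym/eqP; rewrite -subr_eq0; apply/eqP/vw.
have [k|l|u [uB wu]] := TB (f \o w).
- by exists (w k).
- by rewrite /zero_sub /= -[LHS](mxact_linear f) ew; apply: (vZ l).2.
have /choice [t tX] k : exists t, X (j - sh F p.+2 k) t /\ f t = u k.
  by have [t Xt ft] := uB k; exists t.
exists (fun k => w k - mxact (dif F p.+1) t k); split=> [k|k]; last first.
  by rewrite /zero_sub /= mxactB ew (mxact_dif_dif t) subr0 subrr.
split; first apply: gsubB => //.
  by apply: (gsub_mxact gX (@homog_dif p.+1)) => l; apply: (tX l).1.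
rewrite /= linearB [X in _ - X]mxact_linear.
by under eq_bigr do rewrite (tX _).2; apply: wu.
Qed.

End TorVanishing.

(** A complex of vector spaces that is exact at the image of [P] is split there;
    the splitting [P = W a + P b G] consists of scalar matrices and therefore
    survives tensoring with any vector space. *)
Lemma exact_split (K : fieldType) m n r (P : 'M[K]_n) (a : 'M[K]_(m, n)) (b : 'M[K]_(n, r)) :
  (forall v : 'rV_n, v *m P *m b = 0 -> exists w, v *m P = w *m a) ->
  exists W G, P = W *m a + P *m b *m G.
Proof.
move=> ex; pose C := P *m b.
have Ma : ((1%:M - C *m pinvmx C) *m P <= a)%MS.
  apply/row_subP => k; rewrite row_mul; apply/submxP; apply: ex.
  by rewrite -mulmxA -row_mul mulmxBl mul1mx mulmxKpV // subrr row0.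
have [W eW] := submxP Ma; exists W, (pinvmx C *m P).
by rewrite -eW mulmxBl mul1mx -/C mulmxA subrK.
Qed.

Section ResidueTor.
Variables (K : fieldType) (A : stdGraded K).
Local Notation dA := (sgr_sum (sg_ax A)).

Lemma zpiece_scalar (c : K) : zpiece 0 (c%:A : A).
Proof. by rewrite /= (sgr_deg0 (sg_ax A)); exists c. Qed.

Lemma aug_zpiece d (a : A) : zpiece d a -> d != 0 -> aug a = 0.
Proof. by case: d => [[|d]|d] //= => [/aug_pos|->]; rewrite ?raddf0. Qed.

Lemma zpieceZ d (c : K) (a : A) : zpiece d a -> zpiece d (c *: a).
Proof. by move=> Pa; rewrite -[d]add0r -mulr_algl; apply: zpieceMz => //; apply: zpiece_scalar. Qed.

Lemma gsubK (V : lmodType A) (Z : int -> set V) (gZ : graded_sub Z) (c : K) j v :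
  Z j v -> Z j (c%:A *: v).
Proof. by move=> Zv; rewrite -[j]add0r; apply: gsubZ => //; apply: zpiece_scalar. Qed.

(** [B] contains the product of [Z] with the maximal homogeneous ideal. *)
Definition absorbs (V : lmodType A) (Z B : int -> set V) :=
  forall d e (a : A) v, zpiece d a -> aug a = 0 -> Z e v -> B (d + e) (a *: v).

Definition scalar_mx_of m n (X : 'M[K]_(m, n)) : 'M[A]_(m, n) := map_mx (in_alg A) X.

Definition aug_mx m n (X : 'M[A]_(m, n)) : 'M[K]_(m, n) := map_mx (@aug K A) X.

(** Modulo [B], a matrix acts on tuples of elements of [Z] through its reduction
    modulo the maximal ideal. *)
Lemma mxact_aug_mod (V : lmodType A) (Z B : int -> set V) m n
    (a : 'I_m -> int) (b : 'I_n -> int) (X : 'M[A]_(m, n)) v j :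
  graded_sub B -> absorbs Z B -> homog_mx a b X ->
  (forall k, Z (j - a k) (v k)) ->
  forall l, B (j - b l) (mxact X v l - mxact (scalar_mx_of (aug_mx X)) v l).
Proof.
move=> gB ZB hX vZ l; rewrite -mxactBl; apply: (gsub_sum gB) => k _; rewrite !mxE.
have -> : j - b l = (a k - b l) + (j - a k) by ring.
apply: ZB => //; last by rewrite raddfB /= aug_deg0 subrr.
apply: zpieceB => //; case: (eqVneq (a k) (b l)) => [->|ab].
  by rewrite subrr; apply: zpiece_scalar.
by rewrite (aug_zpiece (hX k l)) ?subr_eq0 // rmorph0; apply: zpiece0.
Qed.

Variable F : free_complex A (residue A).
Hypothesis hF : is_free_resolution F.

(** Some basis element of degree [0] maps to a nonzero scalar [c]. If an element
    of [Z j] placed there is a boundary, then applying the augmentation of [F]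
    shows that its multiple by [c] is a combination of elements of [Z] with
    coefficients in the maximal ideal. *)
Lemma tor_vanishes_generators (V : lmodType A) (Z B : int -> set V) j :
  graded_sub Z -> graded_sub B -> absorbs Z B ->
  tor_vanishes F Z zero_sub 0 j -> Z j `<=` B j.
Proof.
move=> gZ gB ZB TZ z Zz.
pose c k : K := cov F k.
have [k0 ck0] : exists k, c k != 0.
  have [v v1] := res_surj hF (1 : K^o).
  apply/existsP; rewrite -negb_forall; apply/negP => /forallP c0.
  have /eqP : (1 : K^o) = 0.
    by rewrite [LHS]v1 big1 // => k _; have /eqP ck := c0 k; rewrite (ck : cov F k = 0) scaler0.
  by rewrite oner_eq0.
have shc k : c k != 0 -> sh F 0 k = 0.
  have := res_cov hF k; rewrite /= /residue_piece; case: eqP => // _ /= ck.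
  by rewrite (ck : c k = 0) eqxx.
pose v k := if k == k0 then z else 0.
have [k|[]|w [wZ vw]] := TZ v.
- rewrite /v; case: eqP => [->|_]; last exact: gsub0.
  by rewrite shc // subr0.
- by [].
have ew k : v k = mxact (dif F 0) w k by apply/eqP; rewrite -subr_eq0; apply/eqP/vw.
pose b l := \sum_k c k *: dif F 0 l k.
have hb l : zpiece (sh F 1 l) (b l).
  apply: zpiece_bigsum => k _; case: (eqVneq (c k) 0) => [->|ck].
    by rewrite scale0r; apply: zpiece0.
  by apply: zpieceZ; rewrite -[sh F 1 l]subr0 -(shc k ck); apply: res_dif hF _ _ _.
have ab l : aug (b l) = 0.
  rewrite -[RHS](dif_cov hF l) raddf_sum; apply: eq_bigr => k _ /=.
  by rewrite -mulr_algl rmorphM /= aug_deg0 mulrC.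
have : B j ((c k0)%:A *: z).
  have -> : (c k0)%:A *: z = \sum_l b l *: w l.
    transitivity (\sum_k (c k)%:A *: v k).
      rewrite (bigD1 k0) //= {1}/v eqxx big1 ?addr0 // => k /negbTE kk.
      by rewrite /v kk scaler0.
    under eq_bigr do rewrite ew scaler_sumr.
    rewrite exchange_big; apply: eq_bigr => l _ /=.
    by rewrite scaler_suml; apply: eq_bigr => k _; rewrite scalerA mulr_algl.
  apply: gsub_sum => // l _.
  have -> : j = sh F 1 l + (j - sh F 1 l) by ring.
  exact: ZB.
move/(gsubK gB (c k0)^-1); rewrite scalerA.
by rewrite -[_%:A * _]scalerAl mul1r scalerA mulVf // !scale1r.
Qed.

(** [Z / B] is a graded vector space living in degrees at most [d], and the
    residue field has a linear resolution, so the complex is a direct sum of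
    copies of [K \otimes F] whose homology sits on the diagonal. The strands of
    [K \otimes F] in degrees above [p] are exact, hence split, and the
    splittings are scalar matrices that act on tuples of elements of [Z]. *)
Lemma tor_vanishes_vector_space (V : lmodType A) (Z B : int -> set V) (d : int) (p : nat) (j : int) :
  graded_sub Z -> graded_sub B -> absorbs Z B ->
  (forall e : int, d < e -> Z e `<=` B e) ->
  (forall e : int, p%:Z < e -> tor_vanishes F (@gm_piece _ _ (residue A)) zero_sub p e) ->
  d + p%:Z < j -> tor_vanishes F Z B p j.
Proof.
move=> gZ gB ZB Zd linF dj v vZ dv.
have hD := homog_dif hF (p := p); have hO := homog_out_dif hF (p := p).
pose a := aug_mx (dif F p); pose b := aug_mx (out_dif F p).
(* The projection to the strand of degree [e]. *)
pose P e : 'M[K]_(rk F p) := \matrix_(k, l) ((k == l) && (sh F p k == e))%:R.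
have vP e (r : 'rV[K]_(rk F p)) k : (r *m P e) 0 k = if sh F p k == e then r 0 k else 0.
  rewrite mxE (bigD1 k) //= big1 ?addr0 => [|l lk].
    by rewrite mxE eqxx /=; case: eqP; rewrite ?mulr1 ?mulr0.
  by rewrite mxE (negbTE lk) mulr0.
have /choice [S SP] e : exists WG : 'M[K]_(rk F p, rk F p.+1) * 'M[K]_(out_rk F p, rk F p),
    p%:Z < e -> P e = WG.1 *m a + P e *m b *m WG.2.
  case: (ltP p%:Z e) => [pe|]; last by exists (0, 0).
  have [r r0|W [G e1]] := @exact_split _ _ _ _ (P e) a b; last by exists (W, G).
  have [k|l|w [_ wP]] := linF e pe (fun k => (r *m P e) 0 k).
  - rewrite vP /= /residue_piece; case: (eqVneq (sh F p k) e) => [->|ke].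
      by rewrite subrr.
    by rewrite subr_eq0 eq_sym (negbTE ke).
  - have /matrixP/(_ 0 l) := r0; rewrite !mxE => e0; rewrite /zero_sub /=.
    by apply: etrans e0; apply: eq_bigr => k _; rewrite [RHS]mulrC [in RHS]mxE.
  exists (\row_k w k); apply/rowP => k; apply/eqP; rewrite -subr_eq0; apply/eqP.
  rewrite -[RHS](wP k); congr (_ - _); rewrite mxE; apply: eq_bigr => l _.
  by rewrite !mxE mulrC.
(* [w] applies in each degree the splitting of the strand of that degree;
   scalars preserve degrees, so its entries stay in [Z]. *)
pose u e k := if sh F p k == e then v k else 0.
have uZ e k : Z (j - sh F p k) (u e k).
  by rewrite /u; case: eqP => // _; apply: gsub0.
pose w k := mxact (scalar_mx_of (S (sh F p.+1 k)).1) (u (sh F p.+1 k)) k.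
have wZ k : Z (j - sh F p.+1 k) (w k).
  apply: gsub_sum => // l _; rewrite mxE; apply: gsubK => //.
  by rewrite /u; case: eqP => [<-|_] //; apply: gsub0.
exists w; split=> // l; set e := sh F p l.
have dwZ : Z (j - e) (mxact (dif F p) w l) by apply: (gsub_mxact gZ hD).
(* In degrees where the strand need not be exact, [Z / B] is zero. *)
case: (leP e p%:Z) => [ep|pe].
  apply: Zd; first by move: dj ep; lia.
  exact: (gsubB gZ (vZ l) dwZ).
have [W [G [eS eP]]] : exists W G, S e = (W, G) /\ P e = W *m a + P e *m b *m G.
  by exists (S e).1, (S e).2; split; [case: (S e)|apply: SP].
have -> : v l = mxact (scalar_mx_of (P e)) (u e) l.
  rewrite /mxact (bigD1 l) //= big1 => [|k kl].
    by rewrite !mxE !eqxx /= scale1r scale1r addr0 /u eqxx.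
  by rewrite !mxE (negbTE kl) raddf0 scale0r.
(* What remains is [G] applied to the boundary of [v] in the strand, which is in
   [B] because [v] is a cycle modulo [B]. *)
rewrite {1}eP /scalar_mx_of map_mxD !map_mxM /= -/(scalar_mx_of _) mxactDl.
have -> : mxact (scalar_mx_of W *m scalar_mx_of a) (u e) l
    = mxact (scalar_mx_of a) w l.
  rewrite mxactM; apply: eq_bigr => k _.
  case: (eqVneq (sh F p.+1 k) e) => [ke|ke]; first by rewrite /w ke eS.
  by rewrite !mxE (aug_zpiece (hD k l)) ?subr_eq0 // raddf0 !scale0r.
rewrite addrAC; apply: (gsubD gB).
  have := gsubB gB (gsub0 gB _) (mxact_aug_mod gB ZB hD wZ l).
  by rewrite sub0r opprB.
rewrite mxactM; apply: gsub_sum => // r _; rewrite mxE; apply: gsubK => //.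
rewrite mxactM.
have Pu : mxact (scalar_mx_of (P e)) (u e) =1 u e.
  move=> k; rewrite /mxact (bigD1 k) //= big1 => [|k' kk].
    by rewrite !mxE eqxx /u; case: eqP => _; rewrite ?scaler0 ?addr0 //= scale1r scale1r.
  by rewrite !mxE (negbTE kk) raddf0 scale0r.
rewrite (eq_mxact _ Pu); case: (eqVneq (out_sh r) e) => [re|re]; last first.
  rewrite /mxact big1 => [|k _]; first exact: gsub0.
  rewrite /u; case: eqP => [ke|_]; last by rewrite scaler0.
  by rewrite !mxE (aug_zpiece (hO k r)) ?raddf0 ?scale0r // subr_eq0 ke eq_sym.
have -> : mxact (scalar_mx_of b) (u e) r = mxact (scalar_mx_of b) v r.
  apply: eq_bigr => k _; rewrite /u; case: eqP => // /eqP ke.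
  by rewrite !mxE (aug_zpiece (hO k r)) ?raddf0 ?scale0r // subr_eq0 re.
have := gsubB gB (dv r) (mxact_aug_mod gB ZB hO vZ r).
by rewrite subKr re.
Qed.

End ResidueTor.

(** * The Koszul complex *)

Section KoszulComplex.
Variables (K : fieldType) (R : stdGraded K) (n : nat) (x : linear_basis R n).
Local Notation E := (exterior R n).
Local Notation dK := (kdif x).

Definition ksign (J : {set 'I_n}) (i : 'I_n) : R := (-1) ^+ #|[set j in J | (j < i)%N]|.

Lemma ksign_sqr (J : {set 'I_n}) i : ksign J i * ksign J i = 1.
Proof. by rewrite /ksign -expr2 sqrr_sign. Qed.

Lemma ksignU1 (J : {set 'I_n}) (l i : 'I_n) : l \notin J ->
  ksign (l |: J) i = (if (l < i)%N then -1 else 1) * ksign J i.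
Proof.
move=> lJ; rewrite /ksign; case: ifP => li.
  have -> : [set j in l |: J | (j < i)%N] = l |: [set j in J | (j < i)%N].
    by apply/setP => j; rewrite !inE; case: eqP => // ->.
  by rewrite cardsU1 inE (negbTE lJ) exprS.
rewrite mul1r; congr (_ ^+ _); apply: eq_card => j; rewrite !inE.
by case: eqP => // ->; rewrite li andbF (negbTE lJ).
Qed.


(** Left multiplication by [e_i]. *)
Definition wedge (i : 'I_n) (z : E) : E :=
  [ffun I : {set 'I_n} => if i \in I then ksign I i * (z (I :\ i) : R) else 0].

Lemma wedge0 i : wedge i 0 = 0.
Proof. by apply/ffunP => I; rewrite !ffunE mulr0 if_same. Qed.

(** The Leibniz rule for [e_i z]. In the coefficient of [e_J], moving [e_i] past
    any other [e_l] changes the sign, so only the terms that pair [e_i] with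
    [x_i] survive. *)
Lemma wedge_homotopy i (z : E) : dK (wedge i z) = (x i : R) *: z - wedge i (dK z).
Proof.
apply/eqP; rewrite eq_sym subr_eq; apply/eqP/ffunP => J; rewrite !ffunE.
rewrite [LHS]/(GRing.scale _ _) /=.
case: (boolP (i \in J)) => iJ; last first.
  rewrite addr0 (bigD1 i) //= big1 ?addr0 => [|l /andP[lJ li]].
    rewrite ffunE setU11 setU1K // ksignU1 // ltnn mul1r -/(ksign J i).
    by rewrite mulrAC [_ * (_ * z J)]mulrA ksign_sqr mul1r mulrC.
  by rewrite ffunE in_setU1 eq_sym (negbTE li) (negbTE iJ) mulr0.
pose J' := J :\ i; have iJ' : i \notin J' by rewrite !inE eqxx.
have eJ : J = i |: J' by rewrite finset.setD1K.
have -> : \sum_(l | l \notin J') (-1) ^+ #|[set j in J' | (j < l)%N]| * x l * z (l |: J') =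
    ksign J' i * x i * z J +
    \sum_(l | l \notin J) ksign J' l * x l * z (l |: J').
  rewrite (bigD1 i) //= -/(ksign J' i) -eJ; congr (_ + _).
  by apply: eq_bigl => l; rewrite !inE; case: (eqVneq l i) => [->|_]; rewrite ?iJ ?andbT.
rewrite mulrDr addrCA [X in _ = X + _](_ : _ = x i * z J); last first.
  by rewrite eJ ksignU1 // ltnn mul1r -eJ -mulrA mulrA ksign_sqr mul1r.
rewrite [X in _ = _ + X](_ : _ = 0) ?addr0 //.
rewrite mulr_sumr -big_split big1 // => l lJ /=.
have li : l != i by apply: contraNneq lJ => ->.
have lJ' : l \notin J' by rewrite !inE li.
rewrite ffunE in_setU1 iJ orbT -/(ksign J l) {1}eJ !ksignU1 //.
have -> : (l |: J) :\ i = l |: J'.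
  by apply/setP => j; rewrite !inE; case: (eqVneq j l) => [->|] //=; rewrite li.
have : (i < l)%N = ~~ (l < i)%N by rewrite -leqNgt ltn_neqAle eq_sym (li : (l : nat) != i).
move=> ->; case: (l < i)%N => /=; ring.
Qed.

(** The terms for [(i, l)] and [(l, i)] are opposite; they are matched with each
    other instead of equating the sum to its opposite, which would not suffice in
    characteristic two. *)
Lemma kdif_sqr (z : E) : dK (dK z) = 0.
Proof.
apply/ffunP => J; rewrite !ffunE.
pose f i l := ksign J i * x i * (ksign (i |: J) l * x l * z (l |: (i |: J)) : R).
have -> : \sum_(i | i \notin J) (-1) ^+ #|[set j in J | (j < i)%N]| * x i * (dK z (i |: J)) =
    \sum_(i | i \notin J) \sum_(l | l \notin i |: J) f i l.
  by apply: eq_bigr => i _; rewrite ffunE mulr_sumr.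
pose Q (p : 'I_n * 'I_n) := [&& p.1 \notin J, p.2 \notin J & p.1 != p.2].
have -> : \sum_(i | i \notin J) \sum_(l | l \notin i |: J) f i l = \sum_(p | Q p) f p.1 p.2.
  rewrite pair_big_dep; apply: eq_bigl => -[i l]; rewrite /Q /= !inE negb_or eq_sym.
  by case: (i \notin J); rewrite //= andbC.
rewrite (bigID (fun p : 'I_n * 'I_n => p.1 < p.2)%N) /= addrC.
pose sw (p : 'I_n * 'I_n) := (p.2, p.1).
rewrite (reindex_inj (h := sw)) /=; last by move=> [a b] [c d] [-> ->].
rewrite (eq_bigl (fun p => Q p && (p.1 < p.2)%N)); last first.
  move=> [i l]; rewrite /Q /= -leqNgt [(i < l)%N]ltn_neqAle -[(i : nat) != l]/(i != l).
  by rewrite [l == i]eq_sym; case: (i \in J); case: (l \in J); case: (i != l).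
rewrite -big_split big1 // => -[i l] /andP[/and3P[/= iJ lJ il] lt_il].
rewrite /f /= !ksignU1 // lt_il ltnNge ltnW //= finset.setUCA; ring.
Qed.

End KoszulComplex.

Section KoszulCycles.
Variables (K : fieldType) (R : stdGraded K) (n : nat) (x : linear_basis R n).
Local Notation E := (exterior R n).
Local Notation dK := (kdif x).

(** The part of homological degree [i] and internal degree [j]; the shift is the
    internal degree [i] of [e_I]. *)
Definition kchain (i : nat) (j : int) : set E :=
  [set z : E | (forall I : {set 'I_n}, #|I| != i -> z I = 0) /\
     forall I : {set 'I_n}, zpiece (j - i%:Z) (z I : R)].

Definition kcyc i j : set E := kchain i j `&` [set z | dK z = 0].

Definition kbound i j : set E := dK @` kchain i.+1 j.

Lemma kchain_graded i : graded_sub (kchain i).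
Proof.
split=> [j|j u v [u0 uP] [v0 vP]|d j a v Pa [v0 vP]]; split=> I.
- by rewrite ffunE.
- by rewrite ffunE; apply: zpiece0.
- by move=> iI; rewrite !ffunE u0 // v0 // subrr.
- by rewrite !ffunE; apply: zpieceB.
- by move=> iI; rewrite ffunE v0 // scaler0.
- by rewrite ffunE -addrA; apply: zpieceMz.
Qed.

Lemma kcyc_graded i : graded_sub (kcyc i).
Proof.
have gE := kchain_graded i.
split=> [j|j u v [uE /= u0] [vE /= v0]|d j a v Pa [vE /= v0]]; split=> /=.
- exact: gsub0.
- by rewrite linear0.
- exact: gsubB.
- by rewrite linearB /= u0 v0 subrr.
- exact: gsubZ.
- by rewrite linearZ /= v0 scaler0.
Qed.

Lemma kbound_graded i : graded_sub (kbound i).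
Proof.
have gE := kchain_graded i.+1; split=> [j|j _ _ [u uE <-] [v vE <-]|d j a _ Pa [v vE <-]].
- by exists 0; rewrite ?linear0 //; apply: gsub0.
- by exists (u - v); rewrite ?linearB //; apply: gsubB.
- by exists (a *: v); rewrite ?linearZ //; apply: gsubZ.
Qed.

Lemma zpiece_ksign (J : {set 'I_n}) i d (a : R) : zpiece d a -> zpiece d (ksign R J i * a).
Proof.
rewrite /ksign -signr_odd mulr_sign; case: ifP => // _ Pa.
by rewrite -sub0r; apply: zpieceB => //; apply: zpiece0.
Qed.

Lemma kdif_kchain i j z : kchain i.+1 j z -> kchain i j (dK z).
Proof.
move=> [z0 zP]; split=> J.
  move=> iJ; rewrite ffunE big1 // => l lJ.
  by rewrite z0 ?mulr0 // cardsU1 lJ add1n.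
rewrite ffunE; apply: zpiece_bigsum => l lJ; rewrite -mulrA; apply: zpiece_ksign.
have -> : j - i%:Z = 1%:Z + (j - i.+1%:Z) by rewrite intS; ring.
by apply: zpieceM => //; apply: lb_in.
Qed.

Lemma kbound_kcyc i j : kbound i j `<=` kcyc i j.
Proof. by move=> _ [z Ez <-]; split; [apply: kdif_kchain|apply: kdif_sqr]. Qed.

Lemma wedge_kchain l i j z : kchain i j z -> kchain i.+1 (1%:Z + j) (wedge l z).
Proof.
move=> [z0 zP]; split=> I.
  move=> iI; rewrite ffunE; case: ifP => // lI; rewrite z0 ?mulr0 //.
  by apply: contra iI => /eqP <-; rewrite (cardsD1 l I) lI.
rewrite ffunE; case: ifP => // lI; last exact: zpiece0.
have -> : 1%:Z + j - i.+1%:Z = j - i%:Z by rewrite intS; ring.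
exact: zpiece_ksign.
Qed.

(** If [z] is a cycle then [x_l z] is the boundary of [e_l z], and the [x_l]
    generate the maximal ideal. *)
Lemma kcyc_absorbs i : absorbs (kcyc i) (kbound i).
Proof.
have gB := kbound_graded i.
have B1 (a : R) e z : sg_piece 1 a -> kcyc i e z -> kbound i (1%:Z + e) (a *: z).
  move=> /(lb_span x) [c ->] [Ez /= dz]; rewrite scaler_suml.
  apply: (gsub_sum gB) => l _; rewrite -mulr_algl -scalerA; apply: gsubK => //.
  exists (wedge l z); first exact: wedge_kchain.
  by rewrite wedge_homotopy dz wedge0 subr0.
move=> [[|d]|d] e a z Pa a0 Zz.
- move: Pa a0; rewrite /= (sgr_deg0 (sg_ax R)) => -[c _ <-]; rewrite aug_deg0 => ->.
  by rewrite !scale0r; apply: gsub0.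
- move: Pa => /=; rewrite -add1n (sgr_mul (sg_ax R)) => -[s sP ->].
  rewrite scaler_suml big_seq; apply: (gsub_sum gB) => u /sP [u1 u2].
  rewrite mulrC -scalerA addnC PoszD -addrA; apply: (gsubZ gB) => //.
  exact: B1.
- by move: Pa => /= ->; rewrite scale0r; apply: gsub0.
Qed.

Variable F : free_complex R (residue R).
Hypothesis hF : is_free_resolution F.

(** For [p = 0] every tuple is a cycle, and the degree condition is what forces
    it into the image: its entries at the basis elements that map to nonzero
    scalars have positive degree, so they annihilate the residue field. *)
Lemma row_exact p e (r : 'rV[R]_(rk F p)) : p%:Z < e ->
  (forall k, zpiece (e - sh F p k) (r 0 k)) -> r *m out_dif F p = 0 ->
  exists w, r = w *m dif F p.
Proof.
case: p r => [|p] r pe rP r0; last by apply/(res_exactS hF).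
apply/(res_exact0 hF); rewrite big1 // => k _.
have := res_cov hF k; rewrite /= /residue_piece; case: eqP => [s0 _|_ /= ->]; last exact: scaler0.
have -> : r 0 k *: cov F k = (aug (r 0 k) : K^o) *: (cov F k : K^o) by [].
rewrite (aug_zpiece (rP k)) ?scale0r // s0 subr0.
by move: pe; rewrite lt_neqAle eq_sym => /andP[].
Qed.

(** The chains of homological degree [i] are a sum of copies of the ring, one for
    each coefficient of [e_I], shifted to degree [i]. *)
Lemma tor_vanishes_kchain i p (j : int) :
  i%:Z + p%:Z < j -> tor_vanishes F (kchain i) zero_sub p j.
Proof.
move=> ij v vE dv.
have wI (I : {set 'I_n}) : exists w : 'rV[R]_(rk F p.+1),
    [/\ forall k, zpiece (j - i%:Z - sh F p.+1 k) (w 0 k),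
        \row_k (v k I : R) = w *m dif F p & #|I| != i -> w = 0].
  case: (eqVneq #|I| i) => [_|iI]; last first.
    exists 0; split=> // [k|]; first by rewrite mxE; apply: zpiece0.
    by rewrite mul0mx; apply/rowP => k; rewrite !mxE (vE k).1.
  have hr k : zpiece (j - i%:Z - sh F p k) ((\row_k (v k I : R)) 0 k).
    by rewrite mxE addrAC; apply: (vE k).2.
  have r0 : \row_k (v k I : R) *m out_dif F p = 0.
    apply/rowP => l; have /ffunP/(_ I) := dv l; rewrite /mxact sum_ffunE ffunE !mxE => dvI.
    by apply: etrans dvI; apply: eq_bigr => k _; rewrite !mxE ffunE mulrC.
  have [k0 l|k0|w hw ew] := homog_mx_lift (a := fun=> j - i%:Z)
      (X := \row_k (v k I : R)) _ (homog_dif hF (p := p)).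
  - by rewrite ord1; apply: hr.
  - rewrite [row _ _](_ : _ = \row_k (v k I : R)); last by apply/rowP => k; rewrite !mxE.
    by apply: row_exact hr r0; move: ij; lia.
  by exists w; split=> // k; apply: hw.
have {wI}/choice [w wP] := wI.
exists (fun k => [ffun I => w I 0 k]); split=> k.
  split=> I; rewrite ffunE; have [w1 _ w0] := wP I.
    by move=> /w0 ->; rewrite mxE.
  by rewrite addrAC.
rewrite /zero_sub /=; apply/eqP; rewrite subr_eq0; apply/eqP/ffunP => I.
have [_ /rowP/(_ k) + _] := wP I; rewrite !mxE => ->.
by rewrite /mxact sum_ffunE; apply: eq_bigr => l _; rewrite !ffunE mulrC.
Qed.

Hypothesis linF : forall p (e : int), p%:Z < e ->
  tor_vanishes F (@gm_piece _ _ (residue R)) zero_sub p e.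

(** In the step to [i + 1], Tor in homological degree [p] is bounded by Tor of
    [Z_i] in degree [p + 1] and Tor of [Z_i / B_i] in degree [p + 2]. Both
    vanish above degree [2 i + p + 2], which is the bound [2 (i + 1) + p]. *)
Lemma tor_vanishes_kcyc i p (j : int) :
  (2 * i + p)%N%:Z < j -> tor_vanishes F (kcyc i) zero_sub p j.
Proof.
elim: i p j => [|i IHi] p j ij.
  move=> v vZ dv; have [|k|w [wE vw]] := @tor_vanishes_kchain 0 p j _ v _ dv.
  - by move: ij; lia.
  - exact: (vZ k).1.
  exists w; split=> // k; split=> //=; apply/ffunP => J; rewrite !ffunE big1 // => l lJ.
  by rewrite (wE k).1 ?mulr0 // cardsU1 lJ.
have gZ := kcyc_graded i; have gB := kbound_graded i.
apply: (tor_vanishes_ker (f := dK) hF (kchain_graded i.+1)).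
  by apply: tor_vanishes_kchain; move: ij; lia.
apply: (@tor_vanishes_sub _ _ _ _ hF _ (kcyc i) (kbound i)) => //; first exact: kbound_kcyc.
  by apply: IHi; move: ij; lia.
apply: (tor_vanishes_vector_space (d := (2 * i)%N) hF) => //.
- exact: kcyc_absorbs.
- move=> e ie; apply: (tor_vanishes_generators hF) => //; first exact: kcyc_absorbs.
  by apply: IHi; rewrite addn0.
- by move=> e; apply: linF.
by move: ij; lia.
Qed.

(** The cycles are generated in degrees at most [2 i], and products with elements
    of the maximal ideal are boundaries. *)
Lemma kcyc_sub_kbound i (j : int) : (2 * i)%N%:Z < j -> kcyc i j `<=` kbound i j.
Proof.
move=> ij; apply: (tor_vanishes_generators hF).
- exact: kcyc_graded.
- exact: kbound_graded.
- exact: kcyc_absorbs.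
by apply: tor_vanishes_kcyc; rewrite addn0.
Qed.

End KoszulCycles.

(** * Independence of Tor from the resolution *)

Lemma dependent_sequence (T : nat -> Type) (Q : forall p, T p -> Prop)
    (step : forall p, T p -> T p.+1 -> Prop) (t0 : T 0) :
  Q 0 t0 -> (forall p t, Q p t -> exists2 t', Q p.+1 t' & step p t t') ->
  exists f : forall p, T p,
    [/\ f 0 = t0, forall p, Q p (f p) & forall p, step p (f p) (f p.+1)].
Proof.
move=> Q0 ex; have ex' p (t : {t | Q p t}) : exists t' : {t | Q p.+1 t}, step p (sval t) (sval t').
  by have [t' Qt' st] := ex p _ (svalP t); exists (exist _ t' Qt').
pose next p t := projT1 (cid (ex' p t)).
pose f := nat_rect (fun p => {t : T p | Q p t}) (exist _ t0 Q0) next.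
exists (fun p => sval (f p)); split=> // p; first exact: svalP (f p).
exact: projT2 (cid (ex' p (f p))).
Qed.

Section Comparison.
Variables (K : fieldType) (A : stdGraded K) (N : gmodule A).

(** The invariant carried through the recursion is that [dif F p *m f] factors
    through [dif G p]; exactness of [G] restores it one step further. *)
Lemma lift_resolution (F G : free_complex A N) :
  is_free_resolution F -> is_free_resolution G ->
  exists phi : forall p, 'M[A]_(rk F p, rk G p),
    [/\ forall p, homog_mx (sh F p) (sh G p) (phi p),
        forall p, dif F p *m phi p = phi p.+1 *m dif G p &
        forall k, cov F k = \sum_l phi 0%N k l *: cov G l].
Proof.
move=> hF hG.
have /choice [v vP] k := res_surj hG (cov F k).
pose phi0 := \matrix_(k, l) component (zpiece_sum A) (v k 0 l) (sh F 0 k - sh G 0 l).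
have h0 : homog_mx (sh F 0) (sh G 0) phi0.
  by move=> k l; rewrite mxE; apply: component_in.
have cov0 k : cov F k = \sum_l phi0 k l *: cov G l.
  rewrite -[LHS](component_id (gm_sum N) (res_cov hF k)) [in LHS]vP component_sum.
  apply: eq_bigr => l _; rewrite mxE -(component_act_homog _ _ (res_cov hG l)).
  by rewrite subrK.
pose Q p (f : 'M[A]_(rk F p, rk G p)) := homog_mx (sh F p) (sh G p) f /\
  forall k, exists w, row k (dif F p *m f) = w *m dif G p.
have Q0 : Q 0%N phi0.
  split=> // k; apply/(res_exact0 hG); rewrite -[RHS](dif_cov hF k).
  under [RHS]eq_bigr do rewrite cov0 scaler_sumr.
  rewrite exchange_big; apply: eq_bigr => l _ /=.
  by rewrite !mxE scaler_suml; apply: eq_bigr => r _; rewrite scalerA.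
have [|f [f0 fQ fS]] := dependent_sequence
  (step := fun p f g => dif F p *m f = g *m dif G p) Q0; last first.
  by exists f; split=> // [p|]; [apply: (fQ p).1|rewrite f0].
move=> p f [hf fP].
have [g hg eg] := homog_mx_lift (homog_mxM (homog_dif hF (p := p)) hf) (homog_dif hG (p := p)) fP.
exists g => //; split=> // k; apply/(res_exactS hG).
by rewrite -row_mul -mulmxA -eg mulmxA (dif_out_dif hF p.+1) mul0mx row0.
Qed.

(** A lift of the zero map of [N] is null-homotopic: what is left of [chi p]
    after the homotopy found so far is a cycle, hence factors through the next
    differential. *)
Lemma null_homotopic_lift (F : free_complex A N) (hF : is_free_resolution F)
    (chi : forall p, 'M[A]_(rk F p)) :
  (forall p, homog_mx (sh F p) (sh F p) (chi p)) ->
  (forall p, dif F p *m chi p = chi p.+1 *m dif F p) ->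
  (forall k, \sum_l chi 0%N k l *: cov F l = 0) ->
  exists h : forall p, 'M[A]_(rk F p, rk F p.+1),
    [/\ forall p, homog_mx (sh F p) (sh F p.+1) (h p), chi 0%N = h 0%N *m dif F 0 &
        forall p, chi p.+1 = dif F p *m h p + h p.+1 *m dif F p.+1].
Proof.
move=> hchi dchi chi0.
have [k|h0 hh0 e0] := homog_mx_lift (hchi 0%N) (homog_dif hF (p := 0%N)).
  by apply/(res_exact0 hF); rewrite -[RHS](chi0 k); apply: eq_bigr => l _; rewrite mxE.
pose Q p (f : 'M[A]_(rk F p, rk F p.+1)) := homog_mx (sh F p) (sh F p.+1) f /\
  dif F p *m (chi p - f *m dif F p) = 0.
have Q0 : Q 0%N h0 by split=> //; rewrite -e0 subrr mulmx0.
have [|h [eh hQ hS]] := dependent_sequence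
  (step := fun p f g => chi p.+1 = dif F p *m f + g *m dif F p.+1) Q0; last first.
  by exists h; split=> // [p|]; [apply: (hQ p).1|rewrite eh].
move=> p f [hf fP].
have hX := homog_mxB (hchi p.+1) (homog_mxM (homog_dif hF (p := p)) hf).
have [k|g hg eg] := homog_mx_lift hX (homog_dif hF (p := p.+1)).
  apply/(res_exactS hF); rewrite -row_mul mulmxBl -dchi -mulmxA -mulmxBr fP.
  exact: row0.
exists g; last by rewrite -eg addrC subrK.
by split=> //; rewrite -eg subKr mulmxA (dif_out_dif hF p.+1) mul0mx.
Qed.

(** Lifting the identity both ways gives [f] and [g], and [1 - f g] is
    null-homotopic. A cycle over [F] is carried by [f] to a boundary over [G],
    and differs from its image under [f g] by a boundary. *)
Lemma tor_vanishes_comparison (F G : free_complex A N) (V : lmodType A)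
    (Z : int -> set V) p j :
  is_free_resolution F -> is_free_resolution G -> graded_sub Z ->
  tor_vanishes G Z zero_sub p j -> tor_vanishes F Z zero_sub p j.
Proof.
move=> hF hG gZ TG v vZ dv.
have [f [hf fS f0]] := lift_resolution hF hG.
have [g [hg gS g0]] := lift_resolution hG hF.
pose chi q := 1%:M - f q *m g q.
have [q|q|k|h [hh h0 hS]] := null_homotopic_lift hF (chi := chi).
- by apply: homog_mxB; [apply: homog_mx1|apply: homog_mxM].
- by rewrite mulmxBr mulmxBl mulmx1 mul1mx mulmxA fS -mulmxA gS mulmxA.
- under eq_bigr do rewrite !mxE scalerBl.
  rewrite sumrB (bigD1 k) //= eqxx scale1r big1 ?addr0 => [|l lk]; last first.
    by rewrite eq_sym (negbTE lk) scale0r.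
  apply/eqP; rewrite subr_eq0; apply/eqP.
  rewrite [LHS]f0; under [LHS]eq_bigr do rewrite g0 scaler_sumr.
  rewrite exchange_big; apply: eq_bigr => l _ /=.
  by rewrite scaler_suml; apply: eq_bigr => r _; rewrite scalerA.
have fv_cycle l : mxact (out_dif G p) (mxact (f p) v) l = 0.
  case: p v vZ dv l {TG} => [|p] v vZ dv l; first by case: l.
  by rewrite -mxactM /= -fS mxactM mxact0 // => r; apply: dv.
have [k|l|u [uZ fv]] := TG (mxact (f p) v).
- exact: gsub_mxact (hf p) vZ k.
- exact: fv_cycle.
have chi_v k : mxact (chi p) v k = mxact (dif F p) (mxact (h p) v) k.
  case: p v vZ dv {TG u uZ fv fv_cycle} k => [|p] v vZ dv k; first by rewrite h0 mxactM.
  by rewrite hS mxactDl !mxactM mxact0 ?add0r // => r; apply: dv.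
exists (fun k => mxact (g p.+1) u k + mxact (h p) v k); split=> k.
  by apply: (gsubD gZ); apply: gsub_mxact uZ k || apply: gsub_mxact vZ k.
have efv k' : mxact (f p) v k' = mxact (dif G p) u k'.
  by apply/eqP; rewrite -subr_eq0; apply/eqP/fv.
have egu : mxact (dif F p) (mxact (g p.+1) u) k = mxact (g p) (mxact (f p) v) k.
  by rewrite -mxactM -gS mxactM (eq_mxact _ efv).
rewrite /zero_sub /=.
have -> : mxact (dif F p) (fun k => mxact (g p.+1) u k + mxact (h p) v k) k =
    mxact (dif F p) (mxact (g p.+1) u) k + mxact (dif F p) (mxact (h p) v) k.
  by rewrite /mxact -big_split; apply: eq_bigr => r _; rewrite scalerDr.
by rewrite egu -chi_v /chi mxactBl mxact1 mxactM addrCA subrr addr0 subrr.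
Qed.

End Comparison.

(** * Regularity in terms of vanishing of Tor *)

(** Needed to read off bounds on the members of a set from a bound on its
    [supremum], whose value is the default when no supremum exists. *)
Lemma ereal_int_has_supremum (S : set (\bar int)) : supremums S !=set0.
Proof.
have [[m mS]|noub] := pselect (exists m : int, ubound S m%:E); last first.
  exists +oo%E; split=> [y _|y yS]; first exact: leey.
  case: y yS => [r||] yS //; first by case: noub; exists r.
  by case: noub; exists 0 => s /yS; rewrite leeNy_eq => /eqP ->; apply: leNye.
have [[s Ss]|noS] := pselect (exists s : int, S s%:E); last first.
  exists -oo%E; split=> [y Sy|y _]; last exact: leNye.
  by case: y Sy => [r||] Sy //; [case: noS; exists r|have := mS _ Sy].
have exk : exists k : nat, `[< ubound S (s + k%:Z)%:E >].
  have sm : s <= m by have := mS _ Ss; rewrite lee_fin.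
  by exists `|m - s|%N; apply/asboolP; rewrite gez0_abs ?subr_ge0 // addrCA subrr addr0.
case: (ex_minnP exk) => k /asboolP kS kmin.
exists (s + k%:Z)%:E; split=> // y yS.
have := yS _ Ss; case: y yS => [r||] yS // sr; last exact: leey.
move: sr; rewrite !lee_fin => sr.
have /kmin : `[< ubound S (s + `|r - s|%N%:Z)%:E >].
  by apply/asboolP; rewrite gez0_abs ?subr_ge0 // addrCA subrr addr0.
lia.
Qed.

Lemma le_supremum (S : set (\bar int)) s : S s -> (s <= supremum -oo S)%E.
Proof. exact: ge_supremum_Nmem (ereal_int_has_supremum S). Qed.

Lemma supremum_le (S : set (\bar int)) y :
  (forall s, S s -> (s <= y)%E) -> (supremum -oo S <= y)%E.
Proof.
move=> Sy; rewrite /supremum; case: ifP => _; first exact: leNye.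
by case: xgetP => [z -> [_]|_]; [apply|exact: leNye].
Qed.

Section Dictionary.
Variables (K : fieldType).

Lemma quotient_dim_eq0 (A : comAlgType K) (V : lmodType A) (Z B : set V) :
  (forall (c : K) v, B v -> B (c%:A *: v)) ->
  quotient_dim Z B = 0%E <-> Z `<=` B.
Proof.
move=> BZ; split=> [q0 z Zz|ZB].
  apply: contrapT => nBz; suff : ((1%N%:Z)%:E <= 0 :> \bar int)%E by rewrite lee_fin.
  rewrite -q0; apply: le_supremum; exists 1%N => //=; exists (fun=> z); split=> // c.
  rewrite big_ord1 => Bc k; rewrite ord1; apply/eqP/negPn/negP => c0.
  apply: nBz; have := BZ (c 0)^-1 _ Bc.
  by rewrite scalerA -[_%:A * _]scalerAl mul1r scalerA mulVf // !scale1r.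
rewrite /quotient_dim (_ : [set _ | n in _] = [set 0%E]) ?supremum1 //.
apply/seteqP; split=> [_ [n [v [vZ vB]] <-]|_ ->].
  case: n v vZ vB => // n v vZ vB; have := vB (fun k => (k == ord0)%:R).
  rewrite (bigD1 ord0) //= big1 => [|k /negbTE ->]; last by rewrite !scale0r.
  rewrite addr0 !scale1r => /(_ (ZB _ (vZ _)) ord0) /eqP.
  by rewrite eqxx oner_eq0.
exists 0%N => //=; exists (fun=> 0); split=> [|c _] [] //.
Qed.

Variable A : stdGraded K.

Lemma resolutionP (N : gmodule A) :
  is_free_resolution (resolution N) \/ resolution N = zero_complex A N.
Proof.
by rewrite /resolution; case: pselect => [ex|_]; [left; apply: projT2 (cid ex)|right].
Qed.

(** The default value taken when there is no resolution has no chains at all. *)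
Lemma tor_vanishes_resolution (N : gmodule A) (V : lmodType A) (Z : int -> set V) p j :
  (is_free_resolution (resolution N) -> tor_vanishes (resolution N) Z zero_sub p j) ->
  tor_vanishes (resolution N) Z zero_sub p j.
Proof.
case: (resolutionP N) => [hF|->]; first exact.
by move=> _ v _ _; exists (fun=> 0); split=> -[].
Qed.

(** The chains of the definition of Tor are finite functions; this passes to
    tuples and the action of the differential matrices. *)
Lemma tor_dim_eq0 (M N : gmodule A) i j :
  tor_dim M N i j = 0%E <-> tor_vanishes (resolution N) (@gm_piece _ _ M) zero_sub i j.
Proof.
have gM := gm_graded_sub M.
have dif_act q (v : tor_chain M N q.+1) : tor_dif v =1 mxact (dif (resolution N) q) v.
  by move=> l; rewrite ffunE.
rewrite /tor_dim quotient_dim_eq0; last first.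
  move=> c _ [w wj <-]; exists (c%:A *: w).
    by move=> k; rewrite ffunE; apply: gsubK.
  apply/ffunP => l; rewrite dif_act ffunE dif_act /mxact scaler_sumr.
  by apply: eq_bigr => k _; rewrite ffunE !scalerA mulrC.
split=> [CB v vj dv|T v [vj dv]].
  have [|w wj ew] := CB [ffun k => v k].
    split=> [k|]; first by rewrite ffunE.
    case: i v vj dv {CB} => [|i] v vj dv //=; apply/ffunP => l.
    rewrite dif_act [RHS]ffunE -[RHS](dv l); apply: eq_bigr => k _; by rewrite ffunE.
  exists w; split=> // k; have /ffunP/(_ k) := ew; rewrite dif_act ffunE => <-.
  by rewrite /zero_sub /= subrr.
have [//|l|w [wj ew]] := T v.
  case: i v vj dv l {T} => [|i] v vj dv l; first by case: l.
  by rewrite /zero_sub /= -dif_act dv ffunE.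
exists [ffun k => w k]; first by move=> k; rewrite ffunE.
apply/ffunP => k; rewrite dif_act; apply/esym/eqP; rewrite -subr_eq0; apply/eqP.
by rewrite -[RHS](ew k); congr (_ - _); apply: eq_bigr => l _; rewrite ffunE.
Qed.

Local Notation FK := (resolution (residue A)).

Lemma top_degree_leP (M : gmodule A) i (d : int) :
  (top_degree M i <= d%:E)%E <->
  forall j : int, d < j -> tor_vanishes FK (@gm_piece _ _ M) zero_sub i j.
Proof.
split=> [le j dj|T].
  apply/tor_dim_eq0/eqP/negPn/negP => b0.
  have : (j%:E <= top_degree M i)%E by apply: le_supremum; exists j.
  by move/le_trans/(_ le); rewrite lee_fin leNgt dj.
apply: supremum_le => _ [j b0 <-]; rewrite lee_fin leNgt; apply/negP => /T /tor_dim_eq0 b1.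
by move: b0; rewrite /= /betti b1 eqxx.
Qed.

Lemma regularity_leP (M : gmodule A) (r : int) :
  (regularity M <= r%:E)%E <->
  forall i (j : int), r + i%:Z < j -> tor_vanishes FK (@gm_piece _ _ M) zero_sub i j.
Proof.
have shift i : ((top_degree M i - (i%:Z)%:E)%E <= r%:E)%E = (top_degree M i <= (r + i%:Z)%:E)%E.
  case: (top_degree M i) => [t||] //=; last by rewrite !leNye.
  by rewrite !lee_fin lerBlDr.
split=> [le i|T].
  apply/top_degree_leP; rewrite -shift; apply: le_trans le; apply: le_supremum.
  by exists i.
by apply: supremum_le => _ [i _ <-]; rewrite shift; apply/top_degree_leP/T.
Qed.

End Dictionary.

(** * The Koszul complex of a polynomial ring *)

Section PolynomialKoszul.
Variables (K : fieldType) (n : nat).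
Local Notation S := (mpoly_graded K n).

Fact poly_basis_in (i : 'I_n) : sg_piece 1 ('X_i : S).
Proof. by rewrite /= /mpoly_piece /= dhomogX /= mdeg1. Qed.

Fact poly_basis_span (a : S) : sg_piece 1 a ->
  exists c : 'I_n -> K, a = \sum_i c i *: ('X_i : S).
Proof.
move=> ha; exists (fun i => (a : {mpoly K[n]})@_(U_(i)%MM)).
rewrite [LHS](mpolyE a); apply/mpolyP => m; rewrite -mpolyE raddf_sum /=.
case: (eqVneq (mdeg m) 1%N) => [/eqP/mdeg1P [k /eqP ->]|m1].
  rewrite (bigD1 k) //= mcoeffZ mcoeffX eqxx mulr1 big1 ?addr0 // => i ik.
  by rewrite mcoeffZ mcoeffX eq_mnm1 (negbTE ik) mulr0.
rewrite (dhomog_nemf_coeff ha m1) big1 // => i _.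
rewrite mcoeffZ mcoeffX; case: eqP => [im|]; last by rewrite mulr0.
by move: m1; rewrite -im mdeg1.
Qed.

Fact poly_basis_free (c : 'I_n -> K) : \sum_i c i *: ('X_i : S) = 0 -> forall i, c i = 0.
Proof.
move=> c0 i; have /mpolyP/(_ U_(i)%MM) := c0; rewrite mcoeff0 => <-.
rewrite raddf_sum (bigD1 i) //= mcoeffZ mcoeffX eqxx mulr1 big1 ?addr0 // => k ki.
by rewrite mcoeffZ mcoeffX eq_mnm1 (negbTE ki) mulr0.
Qed.

Definition poly_basis : linear_basis S n :=
  LinearBasis poly_basis_in poly_basis_span poly_basis_free.

Local Notation E := (exterior S n).
Local Notation dS := (kdif poly_basis).

Definition mpart (m : 'X_{1..n}) (p : {mpoly K[n]}) : {mpoly K[n]} := p@_m *: 'X_[m].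

Lemma mcoeffXiM (i : 'I_n) (p : {mpoly K[n]}) m :
  ('X_i * p)@_m = if m i != 0%N then p@_(m - U_(i)) else 0.
Proof.
case: ifP => mi.
  have le : (U_(i) <= m)%MM by rewrite lep1mP.
  by rewrite mulrC -{1}(submK le) addmC mcoeffMX.
rewrite mcoeffM big1 // => -[m1 m2] /= /eqP em.
rewrite mcoeffX; case: eqP => [e1|]; rewrite ?mul0r //.
have := congr1 (fun u : 'X_{1..n} => u i) em; rewrite -e1 mnmDE mnm1E eqxx => ei.
by rewrite ei in mi.
Qed.

Lemma mpartXiM i p m : mpart m ('X_i * p) =
  if m i != 0%N then 'X_i * mpart (m - U_(i)) p else 0.
Proof.
rewrite /mpart mcoeffXiM; case: ifP => mi; last by rewrite scale0r.
by rewrite -scalerAr -mpolyXD addmC submK // lep1mP.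
Qed.

(** The exponent of the product of the [x_i], [i] in [I]. The element
    [x^m e_I] has multidegree [m + set_mnm I], which the differential
    preserves. *)
Definition set_mnm (I : {set 'I_n}) : 'X_{1..n} := [multinom (i \in I : nat) | i < n].

Definition multi_part (mu : 'X_{1..n}) (z : E) : E :=
  [ffun I => if (set_mnm I <= mu)%MM then mpart (mu - set_mnm I) (z I) else 0].

Lemma set_mnmU1 (i : 'I_n) (J : {set 'I_n}) : i \notin J -> set_mnm (i |: J) = (U_(i) + set_mnm J)%MM.
Proof.
move=> iJ; apply/mnmP => l; rewrite mnmDE mnm1E !mnmE in_setU1 eq_sym.
by case: eqP => // <-; rewrite (negbTE iJ).
Qed.

Lemma multi_part_kdif mu z : dS (multi_part mu z) = multi_part mu (dS z).
Proof.
apply/ffunP => J; rewrite !ffunE; case: ifP => Jmu; last first.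
  rewrite big1 // => i iJ; rewrite ffunE set_mnmU1 //; case: ifP; rewrite ?mulr0 //.
  move=> /mnm_lepP le; move/negP: Jmu; case; apply/mnm_lepP => l; apply: leq_trans (le l).
  by rewrite mnmDE leq_addl.
rewrite /mpart raddf_sum /= scaler_suml; apply: eq_bigr => i iJ.
rewrite -!mulrA -signr_odd !mulr_sign ffunE set_mnmU1 //.
have -> : (U_(i) + set_mnm J <= mu)%MM = ((mu - set_mnm J)%MM i != 0%N).
  rewrite -lep1mP; apply/mnm_lepP/mnm_lepP => le l; have := le l; have := mnm_lepP Jmu l;
    rewrite !mnmDE !mnmBE; lia.
have <- : mpart (mu - set_mnm J) ('X_i * z (i |: J) : {mpoly K[n]}) =
    'X_i * (if (mu - set_mnm J)%MM i != 0%N then mpart (mu - (U_(i) + set_mnm J)) (z (i |: J)) else 0).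
  by rewrite mpartXiM submDA addmC; case: ifP => _; rewrite ?mulr0.
by rewrite /mpart; case: ifP; rewrite // mcoeffN scaleNr.
Qed.

(** If [x_l] occurs in the multidegree of a cycle [w], then [e_l w] is divisible
    by [x_l], and the quotient has boundary [w] because
    [x_l w] is the boundary of [e_l w] and [x_l] is not a zero divisor. *)
Lemma multi_part_exact mu (z : E) : mu != 0%MM -> dS (multi_part mu z) = 0 ->
  exists y, dS y = multi_part mu z.
Proof.
set w := multi_part mu z => mu0 dw.
have [l mul] : exists l, mu l != 0%N.
  apply/existsP; rewrite -negb_forall; apply: contra mu0 => /forallP m0.
  by apply/eqP/mnmP => k; rewrite mnm0E; apply/eqP/m0.
have /choice [y yP] (I : {set 'I_n}) : exists a : {mpoly K[n]}, wedge l w I = 'X_l * a.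
  rewrite ffunE; case: ifP => lI; last by exists 0; rewrite mulr0.
  rewrite ffunE; case: ifP => le; last by exists 0; rewrite !mulr0.
  exists (ksign S I l * ((z (I :\ l) : {mpoly K[n]})@_(mu - set_mnm (I :\ l)) *: 'X_[mu - set_mnm I])).
  rewrite [RHS]mulrCA; congr (_ * _); rewrite /mpart -scalerAr -mpolyXD; congr (_ *: 'X_[_]).
  have -> : set_mnm I = (set_mnm (I :\ l) + U_(l))%MM.
    by rewrite addmC -set_mnmU1 ?finset.setD1K // !inE eqxx.
  rewrite -submDA addmC submK // lep1mP mnmBE mnmE !inE eqxx subn0 //.
exists [ffun I => y I]; apply/ffunP => I.
have Xl0 : 'X_l != 0 :> {mpoly K[n]}.
  by apply/eqP => /(congr1 (mcoeff U_(l))); rewrite mcoeffX eqxx mcoeff0 => /eqP; rewrite oner_eq0.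
apply: (mulfI Xl0).
have -> : 'X_l * dS [ffun I => y I] I = dS ('X_l *: ([ffun I => y I] : E)) I.
  by rewrite linearZ [RHS]ffunE.
rewrite [_ *: _](_ : _ = wedge l w); last by apply/ffunP => J; rewrite yP !ffunE.
by rewrite wedge_homotopy dw wedge0 subr0 [LHS]ffunE.
Qed.

Lemma multi_part_sum (z : E) :
  exists d, z = \sum_(mu : 'X_{1..n < d}) multi_part mu z.
Proof.
exists (\max_I msize (z I : {mpoly K[n]}) + n)%N; apply/ffunP => I.
rewrite sum_ffunE; apply/mpolyP => m; rewrite raddf_sum /=.
have cE (mu : 'X_{1..n}) : (multi_part mu z I : {mpoly K[n]})@_m =
    if mu == (m + set_mnm I)%MM then (z I : {mpoly K[n]})@_m else 0.
  rewrite ffunE; case: ifP => le.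
    rewrite /mpart mcoeffZ mcoeffX -(inj_eq (@addIm _ (set_mnm I))) submK //.
    by case: eqP => [->|_]; rewrite ?mulr0 // addmK mulr1.
  by rewrite mcoeff0; case: eqP => // e; rewrite e lem_addl in le.
under eq_bigr do rewrite cE.
case: (boolP (m \in msupp (z I : {mpoly K[n]}))) => mz; last first.
  by rewrite (memN_msupp_eq0 mz) big1 // => mu _; rewrite if_same.
have dm : (mdeg (m + set_mnm I) < \max_I msize (z I : {mpoly K[n]}) + n)%N.
  rewrite mdegD -addSn leq_add //.
    by apply: leq_trans (msize_mdeg_lt mz) _; apply: (leq_bigmax (F := fun I => msize (z I : {mpoly K[n]}))).
  rewrite mdegE -[X in (_ <= X)%N](card_ord n) -sum1_card leq_sum // => i _.
  by rewrite mnmE; case: (i \in I).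
rewrite (bigD1 (BMultinom dm)) //= eqxx big1 ?addr0 // => mu.
by rewrite bmeqP /= => /negbTE ->.
Qed.

(** Each multidegree part of a cycle is a cycle. The only multidegree that
    involves no variable is [0], where the part is the constant term of the
    coefficient of the empty product. *)
Lemma poly_koszul_exact (z : E) : dS z = 0 ->
  (z finset.set0 : {mpoly K[n]})@_0%MM = 0 -> exists y, dS y = z.
Proof.
move=> dz z0; have [d ez] := multi_part_sum z.
have /choice [y yP] (mu : 'X_{1..n < d}) : exists y, dS y = multi_part mu z.
  case: (eqVneq (mu : 'X_{1..n}) 0%MM) => [->|mu0]; last first.
    by apply: multi_part_exact => //; rewrite multi_part_kdif dz; apply/ffunP => I; rewrite !ffunE /mpart mcoeff0 scale0r if_same.
  exists 0; rewrite linear0; apply/ffunP => I; rewrite !ffunE; case: ifP => // le.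
  have I0 : I = finset.set0.
    apply/setP => i; rewrite inE; apply/negbTE/negP => iI.
    by have := mnm_lepP le i; rewrite mnmE iI mnm0E.
  have -> : (0 - set_mnm I = 0)%MM by apply/mnmP => i; rewrite mnmBE mnm0E sub0n.
  by rewrite I0 /mpart z0 scale0r.
exists (\sum_mu y mu); rewrite linear_sum [RHS]ez; apply: eq_bigr => mu _; exact: yP.
Qed.

End PolynomialKoszul.

(** * The Koszul complex as a complex of based free modules *)

Section KoszulMatrix.
Variables (n : nat) (K : fieldType) (R : stdGraded K) (x : linear_basis R n).
Local Notation E := (exterior R n).
Local Notation dK := (kdif x).

Definition kos_rk i := #|[pred I : {set 'I_n} | #|I| == i]|.

Definition kos_set i (k : 'I_(kos_rk i)) : {set 'I_n} := enum_val k.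

Definition kos_gen (I : {set 'I_n}) : E := [ffun J => (J == I)%:R].

Definition kos_mx i : 'M[R]_(kos_rk i.+1, kos_rk i) :=
  \matrix_(k, l) dK (kos_gen (kos_set k)) (kos_set l).

Definition kos_vec i (v : 'I_(kos_rk i) -> R) : E := \sum_k v k *: kos_gen (kos_set k).

Lemma card_kos_set i (k : 'I_(kos_rk i)) : #|kos_set k| = i.
Proof. by have := enum_valP k; rewrite inE => /eqP. Qed.

Lemma kos_setE i (I : {set 'I_n}) : #|I| = i -> exists k : 'I_(kos_rk i), kos_set k = I.
Proof.
move=> cI; have Ii : I \in [pred I : {set 'I_n} | #|I| == i] by rewrite inE cI.
by exists (enum_rank_in Ii I); rewrite /kos_set enum_rankK_in.
Qed.

Lemma kos_vecE i (v : 'I_(kos_rk i) -> R) k : kos_vec v (kos_set k) = v k.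
Proof.
rewrite sum_ffunE (bigD1 k) //= !ffunE eqxx big1 => [|l lk]; first by rewrite addr0; apply: mulr1.
by rewrite !ffunE (inj_eq enum_val_inj) eq_sym (negbTE lk); apply: mulr0.
Qed.

Lemma kos_vec_out i (v : 'I_(kos_rk i) -> R) (I : {set 'I_n}) : #|I| != i -> kos_vec v I = 0.
Proof.
move=> iI; rewrite sum_ffunE big1 // => l _; rewrite !ffunE; case: eqP => [eI|_]; last exact: mulr0.
by rewrite eI card_kos_set eqxx in iI.
Qed.

Lemma kos_vec_eq i (v : 'I_(kos_rk i) -> R) (z : E) :
  (forall I : {set 'I_n}, #|I| != i -> z I = 0) -> (forall k, z (kos_set k) = v k) -> z = kos_vec v.
Proof.
move=> z0 zv; apply/ffunP => I; case: (eqVneq #|I| i) => [/kos_setE [k <-]|iI].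
  by rewrite zv kos_vecE.
by rewrite z0 // kos_vec_out.
Qed.

Lemma kdif_out i (z : E) (J : {set 'I_n}) :
  (forall I : {set 'I_n}, #|I| != i.+1 -> z I = 0) -> #|J| != i -> dK z J = 0.
Proof.
move=> z0 iJ; rewrite ffunE big1 // => l lJ.
by rewrite z0 ?mulr0 // cardsU1 lJ add1n.
Qed.

Lemma kdif_kos_vec i (v : 'I_(kos_rk i.+1) -> R) :
  dK (kos_vec v) = kos_vec (mxact (V := R^o) (kos_mx i) v).
Proof.
apply: kos_vec_eq => [J|l]; first by apply: kdif_out => I; apply: kos_vec_out.
rewrite linear_sum sum_ffunE; apply: eq_bigr => k _.
by rewrite linearZ ffunE mxE [LHS]mulrC.
Qed.

Lemma kdif_kos_vec0 (v : 'I_(kos_rk 0) -> R) : dK (kos_vec v) = 0.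
Proof.
apply/ffunP => J; rewrite !ffunE big1 // => l lJ.
by rewrite kos_vec_out ?mulr0 // cardsU1 lJ.
Qed.

Lemma kos_mx_homog i : homog_mx (fun=> i.+1%:Z) (fun=> i%:Z) (kos_mx i).
Proof.
move=> k l; rewrite mxE; apply: (kdif_kchain (i := i) x (j := i.+1%:Z) _).2.
split=> I; rewrite ffunE.
  by case: (eqVneq I (kos_set k)) => [->|_] //; rewrite card_kos_set eqxx.
rewrite subrr; case: eqP => _; [exact: sg_piece1|exact: zpiece0].
Qed.

(** Only the part of [y] of homological degree [i + 1] contributes to its
    boundary in homological degree [i]. *)
Lemma kos_vec_bound i (v : 'I_(kos_rk i) -> R) (y : E) : dK y = kos_vec v ->
  v =1 mxact (V := R^o) (kos_mx i) (fun k => y (kos_set k)).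
Proof.
move=> dy k; rewrite -[RHS]kos_vecE -kdif_kos_vec -[LHS]kos_vecE -dy !ffunE.
apply: eq_bigr => l lk; congr (_ * _).
have [r <-] : exists r : 'I_(kos_rk i.+1), kos_set r = l |: kos_set k.
  by apply: kos_setE; rewrite cardsU1 lk card_kos_set.
by rewrite kos_vecE.
Qed.

End KoszulMatrix.

Lemma mxact_row (K : fieldType) (A : stdGraded K) m p (X : 'M[A]_(m, p)) (v : 'rV[A]_m) l :
  (v *m X) 0 l = mxact (V := A^o) X (fun k => v 0 k) l.
Proof. by rewrite mxE; apply: eq_bigr => k _; rewrite mulrC. Qed.

Section PolynomialKoszulResolution.
Variables (n : nat) (K : fieldType).
Local Notation S := (mpoly_graded K n).
Local Notation dS := (kdif (poly_basis K n)).

Definition kos_complex : free_complex S (residue S) :=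
  FreeComplex (rk := kos_rk n) (fun i _ => i%:Z) (kos_mx (poly_basis K n)) (fun=> 1 : K).

Lemma aug_poly (p : S) : aug p = (p : {mpoly K[n]})@_0%MM.
Proof.
have ep : p = \sum_(m <- msupp (p : {mpoly K[n]})) ((p : {mpoly K[n]})@_m *: 'X_[m] : S).
  exact: mpolyE.
rewrite [X in aug X]ep raddf_sum [in RHS](mpolyE p) raddf_sum; apply: eq_bigr => m _ /=.
rewrite mcoeffZ mcoeffX -mulr_algl rmorphM /= aug_deg0; congr (_ * _).
case: eqP => [->|/eqP m0]; first by rewrite mpolyX0 rmorph1.
have : sg_piece (mdeg m).-1.+1 ('X_[m] : S).
  by rewrite /= /mpoly_piece /= dhomogX prednK // lt0n mdeg_eq0.
exact: aug_pos.
Qed.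

Lemma kos_exact i (v : 'rV[S]_(kos_rk n i)) : dS (kos_vec (fun k => v 0 k)) = 0 ->
  (i = 0%N -> forall k, aug (v 0 k) = 0) -> exists w, v = w *m kos_mx (poly_basis K n) i.
Proof.
move=> dv v0; have [|y dy] := poly_koszul_exact dv.
  case: (eqVneq i 0%N) => [i0|i0]; last by rewrite kos_vec_out ?mcoeff0 // cards0 eq_sym.
  have [k <-] : exists k : 'I_(kos_rk n i), kos_set k = finset.set0.
    by apply: kos_setE; rewrite cards0.
  by rewrite kos_vecE -aug_poly v0.
exists (\row_k y (kos_set k)); apply/rowP => l; rewrite (kos_vec_bound dy l) mxact_row.
by apply: eq_bigr => k _; rewrite [(\row_r y (kos_set r)) 0 k]mxE.
Qed.

Lemma kos_rk0_eq (k l : 'I_(kos_rk n 0)) : k = l.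
Proof.
apply: enum_val_inj; have := card_kos_set k; have := card_kos_set l.
by move=> /cards0_eq + /cards0_eq; rewrite /kos_set => -> ->.
Qed.

Lemma kos_complex_resolution : is_free_resolution kos_complex.
Proof.
have [k0 _] : exists k : 'I_(kos_rk n 0), kos_set k = finset.set0.
  by apply: kos_setE; rewrite cards0.
have cov1 (v : 'rV[S]_(kos_rk n 0)) :
    \sum_k v 0 k *: cov kos_complex k = (aug (v 0 k0) : residue S).
  rewrite (bigD1 k0) //= big1 ?addr0 => [|k]; last by rewrite (kos_rk0_eq k k0) eqxx.
  exact: mulr1.
have mul_dif i (v : 'rV[S]_(kos_rk n i)) (w : 'rV[S]_(kos_rk n i.+1)) : v = w *m kos_mx (poly_basis K n) i ->
    kos_vec (fun k => v 0 k) = dS (kos_vec (fun k => w 0 k)).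
  move=> ->; rewrite kdif_kos_vec; congr (kos_vec _); apply/funext => l; exact: mxact_row.
split=> [i k l|k|y|v|i v].
- exact: kos_mx_homog.
- by [].
- by exists (const_mx (y : K)%:A); rewrite cov1 mxE aug_deg0.
- rewrite cov1; split=> [v0|[w ->]].
    apply: kos_exact; first exact: kdif_kos_vec0.
    by move=> _ k; rewrite (kos_rk0_eq k k0).
  rewrite mxE raddf_sum big1 // => k _; rewrite [LHS](rmorphM (@aug K S)).
  rewrite [X in _ * X](_ : _ = 0) ?mulr0 //.
  exact: (aug_pos (i := 0) (kos_mx_homog (poly_basis K n) k k0)).
- split=> [dv|[w /mul_dif vw]].
    apply: kos_exact => //; rewrite kdif_kos_vec; apply/ffunP => I.
    rewrite [kos_vec _](_ : _ = 0) // /kos_vec big1 // => l _.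
    by rewrite -mxact_row dv mxE scale0r.
  apply/rowP => l; rewrite mxact_row mxE -(kos_vecE _ l) -kdif_kos_vec vw.
  by rewrite kdif_sqr ffunE.
Qed.

End PolynomialKoszulResolution.

(** * Conclusion *)

Section Conclusion.
Variables (K : fieldType) (R : stdGraded K) (n : nat) (x : linear_basis R n).

Lemma tor_vanishes_koszul_cycles (F : free_complex R (residue R)) i p j :
  tor_vanishes F (kcyc x i) zero_sub p j ->
  tor_vanishes F (@gm_piece _ _ (koszul_cycles x i)) zero_sub p j.
Proof.
pose val_k (z : koszul_cycles x i) : exterior R n := kcycle_val z.
have kcycP (z : koszul_cycles x i) e : gm_piece e z <-> kcyc x i e (val_k z).
  case: z => z zP; rewrite /val_k /=; split=> [zj|[[_ zj] _]] //.
  move: (zP); rewrite inE => /andP[/forallP z0 /eqP dz]; split=> //; split=> // I iI.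
  exact: eqP (implyP (z0 I) iI).
have val_act m q (X : 'M[R]_(m, q)) v l : val_k (mxact X v l) = mxact X (val_k \o v) l.
  by apply: (big_morph val_k).
move=> T v vj dv.
have [k|l|w [wj vw]] := T (val_k \o v).
- exact/kcycP.
- by rewrite /zero_sub /= -val_act (dv l).
have mem k : w k \in kcycle_pred x i.
  have [[w0 _] dw] := wj k; rewrite inE; apply/andP; split; last exact/eqP.
  by apply/forallP => I; apply/implyP => /w0 ->.
exists (fun k => KCycle (mem k) : koszul_cycles x i); split=> k; first exact/kcycP.
apply/eqP; rewrite subr_eq0; apply/eqP/val_inj; apply/eqP; rewrite -subr_eq0; apply/eqP.
by rewrite -[RHS](vw k); congr (_ - _); apply: val_act.
Qed.

Lemma sym_map_kos_mx i k l :
  sym_map x (kos_mx (poly_basis K n) i k l) = kos_mx x i k l.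
Proof.
rewrite !mxE !ffunE rmorph_sum; apply: eq_bigr => a _.
rewrite !rmorphM /= rmorphXn rmorphN1 !ffunE rmorph_nat; congr (_ * _ * _).
by rewrite /sym_map mmapX mmap1U.
Qed.

(** With the Koszul complex as resolution, a chain over the polynomial ring
    with values in [R] is an element of the Koszul complex of [R]. *)
Lemma tor_vanishes_over_sym i j : kcyc x i j `<=` kbound x i j ->
  tor_vanishes (kos_complex n K) (@gm_piece _ _ (over_sym x)) zero_sub i j.
Proof.
move=> ZB v vj dv.
have actE q (u : 'I_(kos_rk n q.+1) -> over_sym x) l :
    mxact (kos_mx (poly_basis K n) q) u l = mxact (V := R^o) (kos_mx x q) u l.
  by apply: eq_bigr => k _; rewrite -sym_map_kos_mx.
have [|y [y0 yj] dy] := ZB (kos_vec (v : _ -> R)).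
  split; first split=> I.
  - exact: kos_vec_out.
  - case: (eqVneq #|I| i) => [/kos_setE [k <-]|iI]; first by rewrite kos_vecE; apply: vj.
    by rewrite kos_vec_out //; apply: zpiece0.
  case: i v vj dv {ZB} => [|i] v vj dv /=; first exact: kdif_kos_vec0.
  rewrite kdif_kos_vec /kos_vec big1 // => l _.
  by rewrite -actE (dv l) scale0r.
exists (fun k => y (kos_set k)); split=> k; first exact: yj.
rewrite /zero_sub /= actE -(kos_vec_bound dy k).
exact: subrr.
Qed.

End Conclusion.

Theorem lemma2p10 (K : fieldType) (R : stdGraded K) (n : nat)
    (x : linear_basis R n) (hR : koszul R) :
  (forall i : nat, (regularity (koszul_cycles x i) <= ((2 * i)%N%:Z)%:E)%E) /\
  (forall i : nat, (top_degree (over_sym x) i <= ((2 * i)%N%:Z)%:E)%E).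
Proof.
have linF p (e : int) : p%:Z < e ->
    tor_vanishes (resolution (residue R)) (@gm_piece _ _ (residue R)) zero_sub p e.
  move=> pe; have /regularity_leP : (regularity (residue R) <= 0%:E)%E by rewrite hR.
  by apply; rewrite add0r.
have hF : is_free_resolution (resolution (residue R)).
  case: (resolutionP (residue R)) => // r0.
  have : (regularity (residue R) <= (-1)%:E)%E.
    by apply/regularity_leP => p j _; rewrite r0 => v _ _; exists (fun=> 0); split=> -[].
  by rewrite hR lee_fin.
split=> i.
  apply/regularity_leP => p j ij; apply/tor_vanishes_koszul_cycles.
  by apply: (tor_vanishes_kcyc hF linF).
apply/top_degree_leP => j ij; apply: tor_vanishes_resolution => hS.
apply: (tor_vanishes_comparison hS (kos_complex_resolution n K)).
  exact: gm_graded_sub.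
by apply: tor_vanishes_over_sym; apply: (kcyc_sub_kbound hF linF).
Qed.
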